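(* Let $k\ge1$ be fixed and let observations be available from $k$ consecutive time periods $\mathcal{T}_1,\ldots,\mathcal{T}_k$ with sample sizes $n_1,\ldots,n_k$, where $X_i=\mu_j+\sigma_ie_i$ for $i\in\mathcal{T}_j$. Let $\nu=\beta_1\mu_1+\cdots+\beta_k\mu_k$ for given real coefficients $\beta_1,\ldots,\beta_k$, not all zero. Suppose that $\{e_i\}$ satisfies the strong invariance principle with $\Delta_n=n^{1/4}\log(n)$, i.e. there are standard Brownian motions $\{B_t\}$, $\{B_t^*\}$ with $\max_{1\le i\le n}|S_i-\tau B_i|=o_{\mathrm{a.s.}}(\Delta_n)$ and $\max_{1\le i\le n}|S_i^*-\tau^*B_i^*|=o_{\mathrm{a.s.}}(\Delta_n)$. Assume that for each individual time period $\mathcal{T}_j$, $$\frac{r_{\mathcal{T}_j}\Delta_{n_j}}{\Sigma_{\mathcal{T}_j}}+\frac{r^*_{\mathcal{T}_j}\Delta_{n_j}+\Sigma^{*2}_{\mathcal{T}_j}}{\Sigma_{\mathcal{T}_j}^2}\to0,$$ and that $n_1,\ldots,n_k$ are of the same order (and tend to infinity). Then $$\frac{\sum_{j=1}^k\beta_j\bar X(j)-\nu}{\Lambda_n}\Rightarrow N(0,\tau^2),\qquad\text{where}\quad \Lambda_n^2=\sum_{j=1}^k\Bigl\{\frac{\beta_j^2}{n_j^2}\sum_{i\in\mathcal{T}_j}[X_i-\bar X(j)]^2\Bigr\}.$$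
   Context: Setting: $\{e_i\}$ is a stationary time series with $E(e_i)=0$, $E(e_i^2)=1$; $\sigma_i>0$ are deterministic constants (which may depend on the sample size); $\mu_1,\ldots,\mu_k$ are real constants. $n=n_1+\cdots+n_k$, and the consecutive periods are $\mathcal{T}_j=\{m_{j-1}+1,\ldots,m_j\}$ with $m_0=0$, $m_j=n_1+\cdots+n_j$. $\bar X(j)=n_j^{-1}\sum_{i\in\mathcal{T}_j}X_i$. $S_i=\sum_{l=1}^ie_l$, $S_i^*=\sum_{l=1}^i(e_l^2-1)$. $\tau^2$ and $\tau^{*2}$ are the long-run variances of $\{e_i\}$ and $\{e_i^2-1\}$ (assumed well defined), where the long-run variance of a stationary process with autocovariances $\gamma_k$ is $\gamma_0+2\sum_{k\ge1}\gamma_k$; it is assumed that $\tau^2>0$, and $\tau>0$, $\tau^*\ge0$ are the square roots. Strong invariance principles are understood on a possibly enlarged probability space on which the process is redefined without changing its distribution; the two Brownian motions may be defined on different probability spaces. For period $\mathcal{T}_j$: $r_{\mathcal{T}_j}=|\sigma_{m_j}|+\sum_{i=m_{j-1}+2}^{m_j}|\sigma_i-\sigma_{i-1}|$, $r^*_{\mathcal{T}_j}=|\sigma^2_{m_j}|+\sum_{i=m_{j-1}+2}^{m_j}|\sigma_i^2-\sigma_{i-1}^2|$, $\Sigma^2_{\mathcal{T}_j}=\sum_{i\in\mathcal{T}_j}\sigma_i^2$, $\Sigma^{*2}_{\mathcal{T}_j}=\bigl(\sum_{i\in\mathcal{T}_j}\sigma_i^4\bigr)^{1/2}$. ''Of the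 same order'' means that all ratios $n_j/n_l$ are bounded away from $0$ and $\infty$. $\Rightarrow$ denotes convergence in distribution. *)

(* Defs.v *)
From HB Require Import structures.
From mathcomp Require Import all_boot all_order all_algebra.
From mathcomp Require Import all_classical all_reals all_analysis.
Set Implicit Arguments.
Unset Strict Implicit.
Unset Printing Implicit Defensive.
Import Order.TTheory GRing.Theory Num.Theory.
Import numFieldNormedType.Exports.
Local Open Scope classical_set_scope.
Local Open Scope ring_scope.

(* Discrete-time processes are sequences x_1, x_2, ... of random variables,
   encoded as functions of a nat; the value at index 0 is never used. *)

(* Equality of all finite-dimensional distributions. It is required on
   measurable sets only: the value of a measure on other sets carries no
   information. *)
Definition same_law (R : realType)
    (d : measure_display) (T : measurableType d) (P : probability T R)
    (d' : measure_display) (T' : measurableType d') (P' : probability T' R)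
    (x : nat -> T -> R) (y : nat -> T' -> R) : Prop :=
  forall (m : nat) (A : set (m.-tuple R)), measurable A ->
    pushforward P (fun w => [tuple x i.+1 w | i < m]) A =
    pushforward P' (fun w => [tuple y i.+1 w | i < m]) A.

Definition stationary (R : realType) (d : measure_display)
    (T : measurableType d) (P : probability T R) (x : nat -> T -> R) : Prop :=
  forall h : nat, same_law P P (fun i => x (h + i)%N) x.

Definition autocovariance (R : realType) (d : measure_display)
    (T : measurableType d) (P : probability T R) (x : nat -> T -> R)
    (h : nat) : R :=
  fine (covariance P (x 1%N) (x h.+1)).

(* The square integrability makes every covariance finite, so that [fine]
   never acts on an infinite value. *)
Definition long_run_variance (R : realType) (d : measure_display)
    (T : measurableType d) (P : probability T R) (x : nat -> T -> R)
    (v : R) : Prop :=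
  (forall i : nat, (0 < i)%N -> x i \in Lfun P 2%:E) /\
  (fun m : nat => autocovariance P x 0 +
     2 * \sum_(1 <= h < m) autocovariance P x h) @ \oo --> v.

Definition mutually_independent (R : realType) (d : measure_display)
    (T : measurableType d) (P : probability T R) (I : finType)
    (Y : I -> T -> R) : Prop :=
  forall (J : {set I}) (A : I -> set R), (forall i, measurable (A i)) ->
    P (\bigcap_(i in [set` J]) Y i @^-1` A i) =
    (\prod_(i in J) P (Y i @^-1` A i))%E.

(* Only the values at nonnegative times matter. The second parameter of
   [normal_prob] is the standard deviation. *)
Definition standard_brownian_motion (R : realType) (d : measure_display)
    (T : measurableType d) (P : probability T R)
    (B : R -> {RV P >-> R}) : Prop :=
  [/\ {ae P, forall w, B 0 w = 0},
      forall (m : nat) (t : nat -> R), 0 <= t 0%N ->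
        (forall i, t i < t i.+1) ->
        mutually_independent P
          (fun (i : 'I_m) w => B (t i.+1) w - B (t i) w),
      forall (s t : R) (A : set R), 0 <= s -> s < t -> measurable A ->
        pushforward P (fun w => B t w - B s w) A =
        normal_prob 0 (Num.sqrt (t - s)) A
    & {ae P, forall w, {within `[0, +oo[%classic, continuous (B ^~ w)}}].
Arguments standard_brownian_motion {R d T} P B.

(* The process x may be redefined, with the same law, on another space. *)
Definition strong_invariance_principle (R : realType) (d : measure_display)
    (T : measurableType d) (P : probability T R) (x : nat -> T -> R)
    (tau : R) (Delta : nat -> R) : Prop :=
  exists (d' : measure_display) (T' : measurableType d')
    (P' : probability T' R) (x' : nat -> {RV P' >-> R})
    (B : R -> {RV P' >-> R}),
    [/\ same_law P P' x (fun i => x' i : T' -> R),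
        standard_brownian_motion P' B
      & {ae P', forall w,
          (fun n : nat => \big[Num.max/0]_(1 <= i < n.+1)
             `| \sum_(1 <= l < i.+1) x' l w - tau * B i%:R w |)
          =o_\oo Delta}].

Definition cvg_in_distribution (R : realType) (d : measure_display)
    (T : measurableType d) (P : probability T R) (Z : nat -> T -> R)
    (Q : set R -> \bar R) : Prop :=
  (forall N, measurable_fun setT (Z N)) /\
  forall x : R, {for x, continuous (fun y : R => Q `]-oo, y]%classic)} ->
    (fun N => P [set w | Z N w <= x]) @ \oo --> Q `]-oo, x]%classic.

Definition Delta {R : realType} (n : nat) : R :=
  n%:R `^ (1 / 4) * ln n%:R.

(* Periods are numbered from 0, so that period j : 'I_k consists of the
   indices i with endpoint n j < i <= endpoint n j.+1. *)
Definition endpoint (k : nat) (n : 'I_k -> nat) (j : nat) : nat :=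
  (\sum_(l < k | (l < j)%N) n l)%N.

Definition period (k : nat) (n : 'I_k -> nat) (j : 'I_k) : seq nat :=
  index_iota (endpoint n j).+1 (endpoint n j.+1).+1.

Definition sample_mean (R : realType) (k : nat) (n : 'I_k -> nat)
    (x : nat -> R) (j : 'I_k) : R :=
  (n j)%:R^-1 * \sum_(i <- period n j) x i.

(* r_T is [weight_variation n s j] and r*_T is [weight_variation n (fun i => s i ^+ 2) j]. *)
Definition weight_variation (R : realType) (k : nat) (n : 'I_k -> nat)
    (s : nat -> R) (j : 'I_k) : R :=
  `| s (endpoint n j.+1) | +
  \sum_((endpoint n j).+2 <= i < (endpoint n j.+1).+1) `| s i - s i.-1 |.

Definition Sigma2 (R : realType) (k : nat) (n : 'I_k -> nat)
    (s : nat -> R) (j : 'I_k) : R :=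
  \sum_(i <- period n j) s i ^+ 2.

Definition Sigma_star2 (R : realType) (k : nat) (n : 'I_k -> nat)
    (s : nat -> R) (j : 'I_k) : R :=
  Num.sqrt (\sum_(i <- period n j) s i ^+ 4).

Definition Lambda (R : realType) (k : nat) (n : 'I_k -> nat)
    (beta : 'I_k -> R) (x : nat -> R) : R :=
  Num.sqrt (\sum_(j < k) (beta j ^+ 2 / (n j)%:R ^+ 2 *
    \sum_(i <- period n j) (x i - sample_mean n x j) ^+ 2)).

(* Main.v *)
Require Import Defs.
From HB Require Import structures.
From mathcomp Require Import all_boot all_order all_algebra.
From mathcomp Require Import all_classical all_reals all_analysis.
From mathcomp Require Import measurable_realfun.
From mathcomp Require Import ring lra zify.
Import Order.TTheory GRing.Theory Num.Theory.
Import numFieldNormedType.Exports.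
Local Open Scope classical_set_scope.
Local Open Scope ring_scope.
Set Implicit Arguments.
Unset Strict Implicit.
Unset Printing Implicit Defensive.

(** In period j the centred sum is a weighted sum of the noise, and summation by
    parts bounds its distance to the same weighted sum of Brownian increments
    by the total variation of the weights times the largest error of the
    invariance principle ([abel_bound]). Since the period lengths are
    comparable, that error is of smaller order than Delta at each period
    length, so the first term of the variance condition makes the distance
    negligible against the standard deviation of the Brownian sum
    ([period_weight_annihilates]). The Brownian sum is exactly Gaussian.

    That last fact needs no convolution of normal laws
    ([brownian_weighted_sum]). The variables [a_i (B_(i+1) - B_i)] are
    independent and normal with variances [a_i^2]; so are the increments of B
    between the consecutive times [a_0^2 + ... + a_(i-1)^2]. Independence and
    the marginals determine the joint law ([eq_joint_law]), so both families
    have sums of the same law, and the second sum telescopes to a single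
    increment of B.

    Let V^2 be the sum over j of [beta_j^2 Sigma_j^2 / n_j^2]. Weights
    normalised by V give a central limit theorem for the numerator divided by
    V ([linear_statistic_clt]). For the denominator, [square_deviations] writes
    the sum of squared deviations in period j as [Sigma_j^2 (1 + A_j - D_j^2)],
    where A_j is a weighted sum of [e_i^2 - 1] and D_j a weighted sum of [e_i].
    Both are again close to Gaussian sums, now with variances tending to 0
    ([single_period_cvg0]), hence Lambda / V tends to 1 in probability.

    The invariance principles live on other probability spaces than the data,
    and the two of them on different ones. Each conclusion drawn from one of
    them concerns the law of a single linear statistic, so it can be carried
    back to the original space; numerator and denominator are combined only
    there. The combination is a Slutsky argument
    ([cdf_sandwich_perturb]) phrased with distribution functions that are
    squeezed up to a shift of the argument. *)


(** * Scaling of normal laws *)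

(** Intervals open on the left and closed on the right generate the Borel sets,
    and their probabilities are differences of values of the distribution
    function. *)
Lemma eq_probability_cdf (R : realType) (P Q : probability (measurableTypeR R) R) :
  (forall x : R, P `]-oo, x]%classic = Q `]-oo, x]%classic) ->
  forall A, measurable A -> P A = Q A.
Proof.
move=> PQ A mA.
have PQoc (S : probability (measurableTypeR R) R) (a b : R) : a <= b ->
    S `]a, b]%classic = (S `]-oo, b]%classic - S `]-oo, a]%classic)%E.
  move=> ab.
  have -> : `]a, b]%classic = `]-oo, b] `\` `]-oo, a] :> set R.
    by rewrite -[RHS]setCK setCD setCitvl setUC -[LHS]setCK setCitv.
  rewrite measureD ?setIidr//; first exact: subset_itvl.
  by rewrite -ge0_fin_numE// fin_num_measure.
have H := (@measure_unique _ _ (measurableTypeR R) (@ocitv R)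
  (fun k => `](- k%:R), k%:R]%classic)).
apply: H => //.
- exact: (@ocitvI R).
- by move=> k; exact: is_ocitv.
- rewrite -subTset => x _; exists (Num.truncn `|x|).+1 => //=.
  have := truncnS_gt `|x|; rewrite ltr_norml => /andP[nx xn].
  by rewrite in_itv/= nx ltW.
- move=> _ [[a b]] _ <- /=; have [ab|ba] := leP a b.
    by rewrite !PQoc// !PQ.
  by rewrite set_itv_ge ?measure0// bnd_simp -leNgt ltW.
- by move=> k; rewrite -ge0_fin_numE// fin_num_measure.
Qed.

Lemma normal_cdf_scale (R : realType) (c s x : R) : 0 < c -> 0 < s ->
  normal_prob 0 (c * s) `]-oo, c * x]%classic = normal_prob 0 s `]-oo, x]%classic.
Proof.
move=> c0 s0; rewrite /normal_prob.
have cs0 : 0 < c * s by rewrite mulr_gt0.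
have dF : (fun y : R => c * y)^`()%classic = cst c.
  apply/funext => y; rewrite derive1E deriveM// derive_cst derive_id scaler0 addr0.
  by rewrite scaler1.
have dcF (y : R) : derivable (fun y : R => c * y) y 1 by apply: derivableM.
have cF : continuous (fun y : R => c * y).
  by move=> y; apply: cvgM; [exact: cvg_cst|exact: cvg_id].
rewrite (@increasing_ge0_integration_by_substitutionNy _ (fun y => c * y) _ x)//.
- apply: eq_integral => y _; congr EFin.
  rewrite dF/= !normal_pdfE ?gt_eqF// /normal_peak /normal_fun !fctE/= !subr0.
  rewrite mulrAC; congr (_ * _).
    rewrite exprMn -mulrA -mulrnAr sqrtrM ?sqr_ge0// sqrtr_sqr gtr0_norm//.
    by rewrite invfM mulrAC mulVf ?mul1r// gt_eqF.
  congr expR; rewrite !exprMn -mulrnAr invfM.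
  by rewrite -mulrN mulrACA divff ?mul1r// expf_neq0// gt_eqF.
- by move=> y z _ _ yz; rewrite ltr_pM2l.
- by move=> y _; rewrite dF; exact: cvg_cst.
- by rewrite dF; exact: is_cvg_cst.
- by rewrite dF; exact: cvg_cst.
- split; first by move=> y _; exact: dcF.
  by apply: cvg_at_left_filter; exact: cF.
- by apply: gt0_cvgMrNy => //; exact: cvg_id.
- by apply: continuous_subspaceT => y; apply: continuous_normal_pdf; rewrite gt_eqF.
- by move=> y _; exact: normal_pdf_ge0.
Qed.

Lemma normal_prob_opp (R : realType) (s : R) (A : set (measurableTypeR R)) :
  s != 0 -> measurable A ->
  normal_prob 0 s [set x | A (- x)] = normal_prob 0 s A.
Proof.
move=> s0 mA; rewrite /normal_prob.
have mN : measurable_fun setT (-%R : measurableTypeR R -> measurableTypeR R).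
  by [].
have mf : measurable_fun (A : set R) (fun x : R => (normal_pdf 0 s x)%:E).
  by apply/measurable_funTS/measurable_EFinP; exact: measurable_normal_pdf.
transitivity (\int[pushforward lebesgue_measure (-%R : measurableTypeR R -> measurableTypeR R)]_(x in A) (normal_pdf 0 s x)%:E)%E.
  rewrite (ge0_integral_pushforward mN)//=; last first.
    by move=> x _; rewrite lee_fin normal_pdf_ge0.
  apply: eq_integral => x _; congr EFin.
  by rewrite !normal_pdfE// /normal_fun !subr0 sqrrN.
apply: eq_measure_integral => B mB _; exact: lebesgue_measureN.
Qed.

(** For positive [c] the substitution [y = c x] identifies the distribution
    functions, and these determine the laws; negative [c] reduces to this by
    the symmetry of the centred normal density. *)
Lemma normal_prob_scale (R : realType) (c s : R) (A : set (measurableTypeR R)) :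
  c != 0 -> 0 < s -> measurable A ->
  normal_prob 0 s [set x | A (c * x)] = normal_prob 0 (`|c| * s) A.
Proof.
wlog c0 : c A / 0 < c.
  move=> H cn0 s0 mA; have [c0|c0|c0] := ltgtP c 0; last by rewrite c0 eqxx in cn0.
  - rewrite -(normal_prob_opp (A := [set x | A (c * x)]))//=; last 2 first.
    + by rewrite gt_eqF.
    + rewrite -[X in measurable X]setTI; apply: (_ : measurable_fun setT (fun x : R => c * x)) => //.
      exact: measurable_funM.
    under eq_set do rewrite mulrN -mulNr.
    by rewrite H ?normrN// ?oppr_gt0// oppr_eq0.
  - exact: H.
move=> _ s0 mA; rewrite gtr0_norm//.
have mf : measurable_fun setT (fun x : measurableTypeR R => c * x : measurableTypeR R).
  exact: measurable_funM.
pose X : {mfun measurableTypeR R >-> measurableTypeR R} :=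
  HB.pack (fun x : measurableTypeR R => c * x : measurableTypeR R)
  (isMeasurableFun.Build _ _ (measurableTypeR R) (measurableTypeR R) _ mf).
apply: (@eq_probability_cdf _ (distribution _ X) (normal_prob 0 (c * s))) => // x.
transitivity (normal_prob 0 s `]-oo, c^-1 * x]%classic).
  rewrite /distribution /pushforward; congr normal_prob.
  by apply/seteqP; split => y /=; rewrite !in_itv/= ler_pdivlMl.
by rewrite -(normal_cdf_scale _ c0 s0) mulrA divff ?mul1r// gt_eqF.
Qed.

(** * Joint laws of independent variables *)

(** Boxes form a pi-system that generates the measurable sets of tuples, and
    independence makes the probability of a box the product of the marginal
    probabilities of its sides. *)
Lemma eq_joint_law (R : realType) (d : measure_display) (T : measurableType d)
    (P : probability T R) (d' : measure_display) (T' : measurableType d')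
    (P' : probability T' R) (m : nat) (Y : 'I_m -> T -> R) (Y' : 'I_m -> T' -> R) :
  (forall i, measurable_fun setT (Y i)) ->
  (forall i, measurable_fun setT (Y' i)) ->
  mutually_independent P Y -> mutually_independent P' Y' ->
  (forall i (A : set R), measurable A -> P (Y i @^-1` A) = P' (Y' i @^-1` A)) ->
  forall C : set (m.-tuple R), measurable C ->
    P [set w | C [tuple Y i w | i < m]] = P' [set w | C [tuple Y' i w | i < m]].
Proof.
move=> mY mY' indY indY' YY' C mC.
(* The boxes, that is, the products of one measurable set per coordinate. *)
pose box := [set D : set (m.-tuple R) | exists2 B : 'I_m -> set R,
  forall i, measurable (B i) & D = [set t | forall i, B i (tnth t i)]].
have mtuple d0 (T0 : measurableType d0) (Z : 'I_m -> T0 -> R) :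
    (forall i, measurable_fun setT (Z i)) ->
    measurable_fun setT (fun w => [tuple Z i w | i < m]).
  move=> mZ; apply/measurable_fun_tnthP => i.
  rewrite (_ : _ \o _ = Z i)//.
  by apply/funext => w /=; rewrite tnth_mktuple.
pose X : {mfun T >-> m.-tuple R} := HB.pack (fun w => [tuple Y i w | i < m])
  (isMeasurableFun.Build _ _ _ _ _ (mtuple _ _ _ mY)).
pose X' : {mfun T' >-> m.-tuple R} := HB.pack (fun w => [tuple Y' i w | i < m])
  (isMeasurableFun.Build _ _ _ _ _ (mtuple _ _ _ mY')).
have box_prob d0 (T0 : measurableType d0) (P0 : probability T0 R)
    (Z : 'I_m -> T0 -> R) (B : 'I_m -> set R) :
    (forall i, measurable (B i)) -> mutually_independent P0 Z ->
    P0 [set w | forall i, B i (tnth [tuple Z i w | i < m] i)] =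
    (\prod_(i < m) P0 (Z i @^-1` B i))%E.
  move=> mB /(_ (finset.setTfor _) B mB); rewrite big_mkcond/=.
  under eq_bigr do rewrite inE.
  move=> <-; congr (P0 _); apply/seteqP; split => w /=.
    by move=> H i _; have := H i; rewrite tnth_mktuple.
  by move=> H i; rewrite tnth_mktuple; apply: H; rewrite /= inE.
have boxT : box setT.
  by exists (fun=> setT) => //; apply/seteqP; split.
apply: (@g_sigma_algebra_measure_unique _ R _ box _ (fun=> setT) _ _
  (distribution P X) (distribution P' X')) => //.
- move=> _ [B mB ->].
  rewrite (_ : [set _ | _] = \bigcap_(i in [set: 'I_m]) ((@tnth _ R)^~ i @^-1` B i)).
    apply: fin_bigcap_measurable => // i _.
    by rewrite -[X in measurable X]setTI; apply: measurable_tnth.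
  by apply/seteqP; split => t /= H i; [move=> _|]; exact: H.
- by rewrite bigcup_const.
- move=> _ _ [B mB ->] [B' mB' ->]; exists (fun i => B i `&` B' i).
    by move=> i; exact: measurableI.
  apply/seteqP; split => t /=; first by move=> [H H'] i; split.
  by move=> H; split => i; case: (H i).
- move=> _ [B mB ->]; transitivity (\prod_(i < m) P (Y i @^-1` B i))%E.
    exact: (box_prob _ _ P Y B mB indY).
  transitivity (\prod_(i < m) P' (Y' i @^-1` B i))%E; last exact/esym/(box_prob _ _ P' Y' B mB indY').
  by apply: eq_bigr => i _; exact: YY'.
- by move=> _; rewrite -ge0_fin_numE// fin_num_measure.
- move: C mC; apply: smallest_sub; first exact: smallest_sigma_algebra.
  apply: (big_ind (fun S : set (set (m.-tuple R)) => S `<=` <<s box >>)).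
  + by [].
  + by move=> S S' ? ?; rewrite subUset; split.
  move=> i _ _ [A mA <-]; apply: sub_sigma_algebra.
  exists (fun l => if l == i then A else setT).
    by move=> l; case: ifP.
  rewrite setTI; apply/seteqP; split => t /=; last first.
    by move=> /(_ i); rewrite eqxx.
  by move=> At l; case: eqP => // ->.
Qed.

(** * Weighted sums of Brownian increments *)

(** Used to discard the increments of zero weight before changing the times:
    the new times [t_l] have to be strictly increasing. *)
Lemma mutually_independent_reindex (R : realType) (d : measure_display)
    (T : measurableType d) (P : probability T R) (I I' : finType)
    (Y : I -> T -> R) (f : I' -> I) (g : I' -> R -> R) :
  injective f -> (forall l, measurable_fun setT (g l)) ->
  mutually_independent P Y ->
  mutually_independent P (fun l w => g l (Y (f l) w)).
Proof.
move=> finj mg indY J A mA.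
(* The set A l constrains the variable of index f l, through g l; indices
   outside the range of f are unconstrained. *)
pose A' i := if [pick l | f l == i] is Some l then g l @^-1` A l else setT.
have A'f l : A' (f l) = g l @^-1` A l.
  rewrite /A'; case: pickP => [l' /eqP /finj ->//|/(_ l)].
  by rewrite eqxx.
have mA' i : measurable (A' i).
  rewrite /A'; case: pickP => // l _.
  by rewrite -[X in measurable X]setTI; exact: mg.
have := indY (f @: J)%SET A' mA'.
rewrite big_imset/=; last by move=> l l' _ _ /finj.
under eq_bigr do rewrite A'f.
move=> <-; congr (P _); apply/seteqP; split => w /= H.
  move=> i /= /imsetP[l Jl ->].
  by rewrite /preimage/= A'f; exact: H.
move=> l /= Jl; have := H (f l); rewrite /preimage/= A'f; apply.
exact: imset_f.
Qed.

(** Compare the weighted increments over unit intervals with the plain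
    increments of B over intervals of lengths [a_i^2]: both families are
    independent with the same normal marginals, so their sums have the same
    law, and the second sum is one increment of B. *)
Lemma brownian_weighted_sum (R : realType) (d : measure_display)
    (T : measurableType d) (P : probability T R) (B : R -> {RV P >-> R})
    (m : nat) (a : nat -> R) (A : set R) :
  standard_brownian_motion P B ->
  0 < \sum_(i < m) a i ^+ 2 -> measurable A ->
  P [set w | A (\sum_(i < m) a i * (B i.+1%:R w - B i%:R w))] =
  normal_prob 0 (Num.sqrt (\sum_(i < m) a i ^+ 2)) A.
Proof.
move=> [_ indB lawB _] a0 mA.
pose J := [set i : 'I_m | a i != 0]%SET.
pose m' := #|J|.
pose f (l : 'I_m') : 'I_m := enum_val l.
(* The lengths of the new time intervals; the value 1 past the last index only
   keeps the times strictly increasing. *)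
pose b (l : nat) : R := if insub l is Some l' then a (f l') ^+ 2 else 1.
have bE (l : 'I_m') : b l = a (f l) ^+ 2 by rewrite /b valK.
have af0 l : a (f l) != 0 by have := enum_valP l; rewrite inE.
have b_gt0 l : 0 < b l.
  rewrite /b; case: insub => // l'.
  by rewrite exprn_even_gt0//= af0.
pose t (l : nat) : R := \sum_(i < l) b i.
have tS l : t l.+1 = t l + b l by rewrite /t big_ord_recr.
have t0 : t 0%N = 0 by rewrite /t big_ord0.
have tm : t m' = \sum_(i < m) a i ^+ 2.
  rewrite /t; under eq_bigr do rewrite bE.
  rewrite -(big_enum_val (A := mem J) (fun i => a i ^+ 2)) /= big_mkcond/=.
  apply: eq_bigr => i _; rewrite inE; case: eqP => //= ->.
  by rewrite expr0n.
pose Y (l : 'I_m') w := a (f l) * (B (f l).+1%:R w - B (f l)%:R w).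
pose Y' (l : 'I_m') w := B (t l.+1) w - B (t l) w.
have indY : mutually_independent P Y.
  apply: (@mutually_independent_reindex _ _ _ P _ _
    (fun (i : 'I_m) w => B i.+1%:R w - B i%:R w) f (fun l x => a (f l) * x)).
  - exact: enum_val_inj.
  - by move=> l; exact: measurable_funM.
  - by apply: (indB m (fun i => i%:R)) => // i; rewrite ltr_nat.
have indY' : mutually_independent P Y'.
  by apply: indB => [|i]; rewrite ?t0// tS ltrDl.
have mC : measurable ([set s | A (\sum_(l < m') tnth s l)] : set (m'.-tuple R)).
  rewrite -[X in measurable X]setTI.
  have : measurable_fun setT (fun s : m'.-tuple R => \sum_(l < m') tnth s l).
    by apply: measurable_sum => l; exact: measurable_tnth.
  exact.
have lawY (l : 'I_m') (C : set R) : measurable C ->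
    P (Y l @^-1` C) = P (Y' l @^-1` C).
  move=> mC'; rewrite [RHS]lawB// ?tS ?ltrDl//; last first.
    by rewrite /t sumr_ge0// => i _; exact: ltW.
  rewrite addrAC subrr add0r bE sqrtr_sqr -[X in normal_prob _ X]mulr1.
  rewrite -normal_prob_scale//.
  have -> : 1 = Num.sqrt ((f l).+1%:R - (f l)%:R) :> R.
    by rewrite -natr1 addrAC subrr add0r sqrtr1.
  rewrite -lawB ?ltr_nat//.
  rewrite -[X in measurable X]setTI.
  have : measurable_fun setT (fun x : R => a (f l) * x) by exact: measurable_funM.
  exact.
have := eq_joint_law _ _ indY indY' lawY mC.
have -> : [set w | [set s : m'.-tuple R | A (\sum_(l < m') tnth s l)] [tuple Y i w | i < m']] =
    [set w | A (\sum_(i < m) a i * (B i.+1%:R w - B i%:R w))].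
  apply/seteqP; suff H w : \sum_(l < m') tnth [tuple Y i w | i < m'] l =
      \sum_(i < m) a i * (B i.+1%:R w - B i%:R w) by split => w /=; rewrite H.
  under eq_bigr do rewrite tnth_mktuple.
  rewrite -(big_enum_val (A := mem J) (fun i : 'I_m => a i * (B i.+1%:R w - B i%:R w))) /= big_mkcond/=.
  by apply: eq_bigr => i _; rewrite inE; case: eqP => //= ->; rewrite mul0r.
have -> : [set w | [set s : m'.-tuple R | A (\sum_(l < m') tnth s l)] [tuple Y' i w | i < m']] =
    [set w | A (B (t m') w - B (t 0%N) w)].
  apply/seteqP; suff H w : \sum_(l < m') tnth [tuple Y' i w | i < m'] l =
      B (t m') w - B (t 0%N) w by split => w /=; rewrite H.
  under eq_bigr do rewrite tnth_mktuple.
  by rewrite -(big_mkord xpredT (fun l => B (t l.+1) w - B (t l) w)) telescope_sumr.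
move=> -> //.
- have := lawB (t 0%N) (t m') A. rewrite t0 tm subr0; exact.
- by move=> l; apply: measurable_funM => //; exact: measurable_funB.
- by move=> l; exact: measurable_funB.
Qed.

(** * Coupling linear statistics with Gaussian sums *)

(** Dominated convergence for the indicators of the events of large values. *)
Lemma ae_cvg0_in_probability (R : realType) (d : measure_display)
    (T : measurableType d) (P : probability T R) (D : nat -> T -> R) :
  (forall N, measurable_fun setT (D N)) ->
  {ae P, forall w, D ^~ w @ \oo --> (0 : R)} ->
  forall delta : R, 0 < delta ->
    (fun N => fine (P [set w | delta <= `|D N w|])) @ \oo --> (0 : R).
Proof.
move=> mD D0 delta delta0.
pose E N := [set w | delta <= `|D N w|].
have mE N : measurable (E N).
  rewrite (_ : E N = (fun w => `|D N w|) @^-1` `[delta, +oo[%classic).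
    rewrite -[X in measurable X]setTI.
    have : measurable_fun setT (fun w => `|D N w|) by exact: measurableT_comp.
    exact.
  by apply/seteqP; split => w; rewrite /E/= in_itv/= andbT.
apply: fine_cvg.
have [|||||_ _] := @dominated_convergence _ _ _ P setT measurableT
  (fun N w => (\1_(E N) w : R)%:E) (cst 0%E) (cst 1%E).
- by move=> N; apply/measurable_EFinP; exact: measurable_indic.
- exact: measurable_cst.
- apply: filterS D0 => w Dw _.
  apply: cvg_near_cst.
  have /cvgr0Pnorm_lt/(_ _ delta0) := Dw; apply: filterS => N DN.
  by rewrite indicE memNset// /E/= leNgt DN.
- by apply: finite_measure_integrable_cst.
- apply: aeW => w N _.
  by rewrite indicE; case: (_ \in _); rewrite /= ?normr1 ?normr0 lee_fin.
rewrite integral0 (_ : [sequence _]_n = fun N => P (E N))//.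
by apply/funext => N; rewrite /= integral_indic// setIT.
Qed.

(** The condition on the weights is deterministic: they send to 0 every
    sequence whose partial sums are o(Delta). It is applied to the paths of
    the error [x'_i - tau (B_i - B_(i-1))]. The normal law and the vanishing
    of Z are separate clauses because [normal_prob 0 0] is not the Dirac mass
    at 0. Only the laws of the single Y_N are compared with the original
    space, which is all that limits in law or in probability to a constant
    require. *)
Lemma invariance_coupling (R : realType) (d : measure_display)
    (T : measurableType d) (P : probability T R) (x : nat -> T -> R)
    (tau : R) (Delta : nat -> R) (m : nat -> nat) (a : nat -> nat -> R) :
  strong_invariance_principle P x tau Delta ->
  (forall u : nat -> R,
    (fun n : nat => \big[Num.max/0]_(1 <= i < n.+1) `|\sum_(1 <= l < i.+1) u l|)
      =o_\oo Delta ->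
    (fun N => \sum_(1 <= i < (m N).+1) a N i * u i) @ \oo --> (0 : R)) ->
  exists (d' : measure_display) (T' : measurableType d') (P' : probability T' R)
    (Y Z : nat -> T' -> R),
  [/\ (forall N, measurable_fun setT (Y N)) /\ (forall N, measurable_fun setT (Z N)),
      forall N (A : set R), measurable A ->
        P [set w | A (\sum_(1 <= i < (m N).+1) a N i * x i w)] = P' (Y N @^-1` A),
      forall N (A : set R), measurable A ->
        0 < \sum_(1 <= i < (m N).+1) (tau * a N i) ^+ 2 ->
        P' (Z N @^-1` A) =
        normal_prob 0 (Num.sqrt (\sum_(1 <= i < (m N).+1) (tau * a N i) ^+ 2)) A,
      forall N w, \sum_(1 <= i < (m N).+1) (tau * a N i) ^+ 2 = 0 -> Z N w = 0
    & forall delta : R, 0 < delta ->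
        (fun N => fine (P' [set w | delta <= `|Y N w - Z N w|])) @ \oo --> (0 : R)].
Proof.
move=> [d' [T' [P' [x' [B [xx' BM sip]]]]]] ann.
exists d', T', P'.
pose Y N w := \sum_(1 <= i < (m N).+1) a N i * x' i w.
pose Z N w := \sum_(1 <= i < (m N).+1) (tau * a N i) * (B i%:R w - B i.-1%:R w).
have mY N : measurable_fun setT (Y N).
  by apply: measurable_sum => i; exact: measurable_funM.
have mZ N : measurable_fun setT (Z N).
  by apply: measurable_sum => i; apply: measurable_funM => //; exact: measurable_funB.
exists Y, Z; split => //.
- move=> N A mA.
  have mC : measurable ([set s | A (\sum_(i < m N) a N i.+1 * tnth s i)] : set ((m N).-tuple R)).
    rewrite -[X in measurable X]setTI.
    have : measurable_fun setT (fun s : (m N).-tuple R => \sum_(i < m N) a N i.+1 * tnth s i).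
      by apply: measurable_sum => i; apply: measurable_funM => //; exact: measurable_tnth.
    exact.
  have H1 w : \sum_(i < m N) a N i.+1 * tnth [tuple x i.+1 w | i < m N] i =
      \sum_(1 <= i < (m N).+1) a N i * x i w.
    by rewrite big_add1/= big_mkord; apply: eq_bigr => i _; rewrite tnth_mktuple.
  have H2 w : \sum_(i < m N) a N i.+1 * tnth [tuple x' i.+1 w | i < m N] i = Y N w.
    by rewrite /Y big_add1/= big_mkord; apply: eq_bigr => i _; rewrite tnth_mktuple.
  transitivity (pushforward P' (fun w => [tuple x' i.+1 w | i < m N])
      [set s | A (\sum_(i < m N) a N i.+1 * tnth s i)]).
    rewrite -(xx' _ _ mC); congr (P _).
    by apply/funext => w; rewrite -[LHS]/(A _) -H1.
  congr (P' _); apply/funext => w; rewrite -[RHS]/(A _) -H2//.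
- move=> N A mA; rewrite big_add1/= big_mkord => s0.
  rewrite -(brownian_weighted_sum (m := m N) (a := fun i => tau * a N i.+1) BM)//.
  congr (P' _); apply/seteqP.
  suff H w : Z N w = \sum_(i < m N) tau * a N i.+1 * (B i.+1%:R w - B i%:R w).
    by split => w; rewrite /preimage/= H.
  by rewrite /Z big_add1/= big_mkord.
- move=> N w /eqP; rewrite psumr_eq0; last by move=> i _; exact: sqr_ge0.
  move=> /allP s0; rewrite /Z big1_seq// => i /= /s0.
  by rewrite sqrf_eq0 => /eqP ->; rewrite mul0r.
- apply: ae_cvg0_in_probability; first by move=> N; exact: measurable_funB.
  have [B0 _ _ _] := BM.
  apply: filterS2 sip B0 => w sipw B0w.
  have YZE N : Y N w - Z N w = \sum_(1 <= i < (m N).+1)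
      a N i * (x' i w - tau * (B i%:R w - B i.-1%:R w)).
    rewrite /Y /Z -sumrB; apply: eq_bigr => i _; ring.
  under eq_fun do rewrite YZE; apply: ann.
  rewrite [X in X =o_\oo _](_ : _ = (fun n : nat => \big[Num.max/0]_(1 <= i < n.+1)
             `| \sum_(1 <= l < i.+1) x' l w - tau * B i%:R w |))//.
  apply/funext => n; apply: eq_bigr => i _; congr `|_|.
  rewrite sumrB -mulr_sumr; congr (_ - _ * _).
  rewrite big_add1/= telescope_sumr// B0w subr0//.
Qed.

(** * Convergence of distribution functions up to a shift *)

Lemma measurable_sublevel (R : realType) (d : measure_display)
    (T : measurableType d) (f : T -> R) (x : R) :
  measurable_fun setT f -> measurable [set w | f w <= x].
Proof.
move=> mf; rewrite (_ : [set w | _] = f @^-1` `]-oo, x]%classic).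
  by rewrite -[X in measurable X]setTI; exact: mf.
by apply/seteqP; split => w; rewrite /= in_itv.
Qed.

Lemma measurable_normge (R : realType) (d : measure_display)
    (T : measurableType d) (f : T -> R) (x : R) :
  measurable_fun setT f -> measurable [set w | x <= `|f w|].
Proof.
move=> mf; rewrite (_ : [set w | _] = [set w | - `|f w| <= - x]).
  by apply: measurable_sublevel; apply: measurable_funN; exact: measurableT_comp.
by apply/seteqP; split => w; rewrite /= lerN2.
Qed.

Lemma fine_probability_leU (R : realType) (d : measure_display)
    (T : measurableType d) (P : probability T R) (A B C : set T) :
  measurable A -> measurable B -> measurable C -> A `<=` B `|` C ->
  fine (P A) <= fine (P B) + fine (P C).
Proof.
move=> mA mB mC ABC.
rewrite -fineD ?fin_num_measure// fine_le ?fin_numD ?fin_num_measure//.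
apply: (@le_trans _ _ (P (B `|` C))).
  by apply: le_measure; rewrite ?inE//; exact: measurableU.
exact: measureU2.
Qed.

(** For a probability Q this is convergence in law, in the form suggested by the
    Levy metric. Unlike convergence at
    the continuity points it composes with perturbations without any
    knowledge of the atoms of the limit. *)
Definition cdf_sandwich (R : realType) (d : measure_display)
    (T : measurableType d) (P : probability T R) (U : nat -> T -> R)
    (Q : set R -> \bar R) : Prop :=
  forall x delta eta : R, 0 < delta -> 0 < eta ->
    \forall N \near \oo,
      fine (Q `]-oo, x - delta]%classic) - eta <= fine (P [set w | U N w <= x])
        <= fine (Q `]-oo, x + delta]%classic) + eta.

(** A form of Slutsky's lemma that serves for additive and for multiplicative
    errors. The bad events may depend on the level [x] and on the shift,
    because the error of a quotient is multiplied by [x]. *)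
Lemma cdf_sandwich_perturb (R : realType) (d : measure_display)
    (T : measurableType d) (P : probability T R) (U V : nat -> T -> R)
    (Q : set R -> \bar R) :
  (forall N, measurable_fun setT (U N)) ->
  (forall N, measurable_fun setT (V N)) ->
  cdf_sandwich P U Q ->
  (forall x delta : R, 0 < delta ->
    exists2 bad : nat -> set T,
      (forall N, measurable (bad N)) /\
      (fun N => fine (P (bad N))) @ \oo --> (0 : R)
    & \forall N \near \oo, forall w, ~ bad N w ->
        (V N w <= x -> U N w <= x + delta) /\
        (U N w <= x - delta -> V N w <= x)) ->
  cdf_sandwich P V Q.
Proof.
move=> mU mV UQ UV x delta eta delta0 eta0.
have delta20 : 0 < delta / 2 by rewrite divr_gt0.
have eta20 : 0 < eta / 2 by rewrite divr_gt0.
have [bad [mbad bad0] badUV] := UV x _ delta20.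
have mUl N y : measurable [set w | U N w <= y] by exact: measurable_sublevel.
have mVl N y : measurable [set w | V N w <= y] by exact: measurable_sublevel.
have near_bad : \forall N \near \oo, fine (P (bad N)) < eta / 2.
  have /cvgr0Pnorm_lt/(_ _ eta20) := bad0; apply: filterS => N.
  by apply: le_lt_trans; exact: ler_norm.
near=> N.
have NUV : forall w, ~ bad N w -> (V N w <= x -> U N w <= x + delta / 2) /\
   (U N w <= x - delta / 2 -> V N w <= x) by near: N.
have Nbad : fine (P (bad N)) < eta / 2 by near: N.
have /andP[Ul _] : fine (Q `]-oo, x - delta / 2 - delta / 2]%classic) - eta / 2
    <= fine (P [set w | U N w <= x - delta / 2])
    <= fine (Q `]-oo, x - delta / 2 + delta / 2]%classic) + eta / 2.
  by near: N; exact: UQ.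
have /andP[_ Ur] : fine (Q `]-oo, x + delta / 2 - delta / 2]%classic) - eta / 2
    <= fine (P [set w | U N w <= x + delta / 2])
    <= fine (Q `]-oo, x + delta / 2 + delta / 2]%classic) + eta / 2.
  by near: N; exact: UQ.
have xD : x + delta / 2 + delta / 2 = x + delta by rewrite -addrA -splitr.
have xB : x - delta / 2 - delta / 2 = x - delta by rewrite -addrA -opprD -splitr.
rewrite xB in Ul; rewrite xD in Ur.
have le1 : fine (P [set w | V N w <= x]) <=
    fine (P [set w | U N w <= x + delta / 2]) + fine (P (bad N)).
  apply: fine_probability_leU => // w /= Vx.
  by have [|nb] := pselect (bad N w); [right|left; exact: (NUV w nb).1].
have le2 : fine (P [set w | U N w <= x - delta / 2]) <=
    fine (P [set w | V N w <= x]) + fine (P (bad N)).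
  apply: fine_probability_leU => // w /= Vx.
  by have [|nb] := pselect (bad N w); [right|left; exact: (NUV w nb).2].
apply/andP; split; lra.
Unshelve. all: by end_near. Qed.

Lemma cdf_sandwich_cvg (R : realType) (d : measure_display)
    (T : measurableType d) (P : probability T R) (U : nat -> T -> R)
    (Q : probability (measurableTypeR R) R) :
  (forall N, measurable_fun setT (U N)) ->
  cdf_sandwich P U Q -> cvg_in_distribution P U Q.
Proof.
move=> mU UQ; split => // x Qx.
have mUl N y : measurable [set w | U N w <= y] by exact: measurable_sublevel.
rewrite (_ : (fun N => _) = (fun N => (fine (P [set w | U N w <= x]))%:E)); last first.
  by apply/funext => N; rewrite fineK// fin_num_measure.
rewrite -[Q _]fineK ?fin_num_measure//.
have Fx : fine (Q `]-oo, y]%classic) @[y --> x] --> fine (Q `]-oo, x]%classic).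
  by apply: fine_cvg; rewrite fineK ?fin_num_measure.
apply: cvg_EFin; first by apply: nearW => N.
apply/cvgrPdist_le => /= eta eta0.
have eta20 : 0 < eta / 2 by rewrite divr_gt0.
have /cvgrPdist_le/(_ _ eta20)/nbhs_ballP[delta /= delta0 Fdelta] := Fx.
have delta20 : 0 < delta / 2 by rewrite divr_gt0.
have dd : delta / 2 < delta by rewrite ltr_pdivrMr// ltr_pMr// ltr1n.
have := Fdelta (x + delta / 2); have := Fdelta (x - delta / 2).
rewrite /ball/=.
have -> : x - (x - delta / 2) = delta / 2 by ring.
have -> : x - (x + delta / 2) = - (delta / 2) by ring.
rewrite normrN gtr0_norm// => /(_ dd) F1 /(_ dd) F2.
apply: filterS (UQ x _ _ delta20 eta20) => N /andP[].
rewrite ler_norml.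
move: F1 F2; rewrite !ler_norml => /andP[? ?] /andP[? ?] ? ?.
apply/andP; split; lra.
Qed.

(** * Limit laws of linear statistics *)

(** The coupled variable Z_N has exactly the limit law for large N, and Y_N
    differs from it by an error that vanishes in probability. *)
Lemma linear_statistic_clt (R : realType) (d : measure_display)
    (T : measurableType d) (P : probability T R) (x : nat -> T -> R)
    (tau : R) (Delta : nat -> R) (m : nat -> nat) (a : nat -> nat -> R) :
  0 < tau ->
  strong_invariance_principle P x tau Delta ->
  (forall u : nat -> R,
    (fun n : nat => \big[Num.max/0]_(1 <= i < n.+1) `|\sum_(1 <= l < i.+1) u l|)
      =o_\oo Delta ->
    (fun N => \sum_(1 <= i < (m N).+1) a N i * u i) @ \oo --> (0 : R)) ->
  (\forall N \near \oo, \sum_(1 <= i < (m N).+1) a N i ^+ 2 = 1) ->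
  cdf_sandwich P (fun N w => \sum_(1 <= i < (m N).+1) a N i * x i w)
    (normal_prob 0 tau).
Proof.
move=> tau0 sip ann a1.
have [d' [T' [P' [Y [Z [[mY mZ] lawY lawZ _ YZ]]]]]] := invariance_coupling sip ann.
have lawZ1 : \forall N \near \oo, forall A : set R, measurable A ->
    P' (Z N @^-1` A) = normal_prob 0 tau A.
  apply: filterS a1 => N aN A mA.
  have sE : \sum_(1 <= i < (m N).+1) (tau * a N i) ^+ 2 = tau ^+ 2.
    by under eq_bigr do rewrite exprMn; rewrite -mulr_sumr aN mulr1.
  by rewrite lawZ// sE ?exprn_gt0// sqrtr_sqr gtr0_norm.
have ZQ : cdf_sandwich P' Z (normal_prob 0 tau).
  move=> y delta eta delta0 eta0.
  apply: filterS lawZ1 => N ZN.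
  have -> : P' [set w | Z N w <= y] = normal_prob 0 tau `]-oo, y]%classic.
    by rewrite -ZN.
  have mono (y1 y2 : R) : y1 <= y2 -> fine (normal_prob 0 tau `]-oo, y1]%classic)
      <= fine (normal_prob 0 tau `]-oo, y2]%classic).
    move=> y12; rewrite fine_le ?fin_num_measure// le_measure ?inE//.
    by apply: subset_itvl; rewrite bnd_simp.
  have := mono (y - delta) y; have := mono y (y + delta).
  rewrite lerDl gerBl ltW// => /(_ isT) ? /(_ isT) ?.
  by apply/andP; split; lra.
have YQ : cdf_sandwich P' Y (normal_prob 0 tau).
  apply: (cdf_sandwich_perturb mZ mY ZQ) => y delta delta0.
  exists (fun N => [set w | delta <= `|Y N w - Z N w|]).
    split; last exact: YZ.
    by move=> N; apply: measurable_normge; exact: measurable_funB.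
  apply: nearW => N w /negP; rewrite -ltNge ltr_norml => /andP[? ?].
  split => ?; lra.
move=> y delta eta delta0 eta0; apply: filterS (YQ y _ _ delta0 eta0) => N.
have -> // : P [set w | \sum_(1 <= i < (m N).+1) a N i * x i w <= y] =
    P' [set w | Y N w <= y].
  exact: (lawY N `]-oo, y]%classic).
Qed.

(** Scaling reduces a small standard deviation to a distant tail of the
    standard normal law. *)
Lemma normal_prob_tail (R : realType) (eta eps : R) : 0 < eta -> 0 < eps ->
  exists2 s0 : R, 0 < s0 & forall s, 0 < s -> s <= s0 ->
    fine (normal_prob 0 s [set x | eta <= `|x|]) <= eps.
Proof.
move=> eta0 eps0.
have mF (K : R) : measurable [set x : measurableTypeR R | K <= `|x|].
  by apply: measurable_normge.
pose F n := [set x : measurableTypeR R | n%:R <= `|x|].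
have : normal_prob 0 1 (F n) @[n --> \oo] --> normal_prob 0 1 (\bigcap_n F n).
  apply: nonincreasing_cvg_mu => //.
  - by apply: le_lt_trans (probability_le1 _ (mF _)) _; rewrite ltry.
  - by move=> n; exact: mF.
  - by apply: bigcap_measurable => // n _; exact: mF.
  - move=> n k nk; apply/subsetPset => x /=; apply: le_trans.
    by rewrite ler_nat.
have -> : \bigcap_n F n = set0.
  rewrite -subset0 => x /(_ (Num.truncn `|x|).+1 I); rewrite /F/=.
  by rewrite leNgt truncnS_gt.
rewrite measure0 => /fine_cvg/cvgr0Pnorm_le/(_ _ eps0)[n _ /(_ n (leqnn n))].
move=> /(le_trans (ler_norm _)) /= Fn.
exists (eta / n.+1%:R) => [|s s0 sn]; first by rewrite divr_gt0.
apply: le_trans Fn; rewrite -[s]mulr1 -{1}(gtr0_norm s0).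
rewrite -(normal_prob_scale (c := s)) ?gt_eqF//.
have mG : measurable [set x : measurableTypeR R | eta <= `|s * x|].
  by apply: measurable_normge; exact: measurable_funM.
rewrite fine_le ?fin_num_measure//; first exact: mF.
apply: le_measure; rewrite ?inE//; first exact: mF.
move=> x /=; rewrite normrM gtr0_norm// => sx.
have x0 : 0 <= `|x| by [].
have := le_trans sx (ler_wpM2r x0 sn).
rewrite -mulrA ler_pMr// mulrC ler_pdivlMr// mul1r; apply: le_trans.
by rewrite ler_nat.
Qed.

(** Centred normal laws concentrate at 0 as their variances tend to 0, and a
    Gaussian sum of zero variance has only zero weights. *)
Lemma linear_statistic_cvg0 (R : realType) (d : measure_display)
    (T : measurableType d) (P : probability T R) (x : nat -> T -> R)
    (tau : R) (Delta : nat -> R) (m : nat -> nat) (a : nat -> nat -> R) :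
  strong_invariance_principle P x tau Delta ->
  (forall u : nat -> R,
    (fun n : nat => \big[Num.max/0]_(1 <= i < n.+1) `|\sum_(1 <= l < i.+1) u l|)
      =o_\oo Delta ->
    (fun N => \sum_(1 <= i < (m N).+1) a N i * u i) @ \oo --> (0 : R)) ->
  (fun N => \sum_(1 <= i < (m N).+1) a N i ^+ 2) @ \oo --> (0 : R) ->
  forall eta : R, 0 < eta ->
    (fun N => fine (P [set w | eta <= `|\sum_(1 <= i < (m N).+1) a N i * x i w|]))
      @ \oo --> (0 : R).
Proof.
move=> sip ann a0 eta eta0.
have [d' [T' [P' [Y [Z [[mY mZ] lawY lawZ Z0 YZ]]]]]] := invariance_coupling sip ann.
have eta20 : 0 < eta / 2 by rewrite divr_gt0.
have mA (y : R) : measurable [set z : R | y <= `|z|] by exact: measurable_normge.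
rewrite (_ : (fun N => _) = fun N => fine (P' [set w | eta <= `|Y N w|])); last first.
  by apply/funext => N; congr fine; exact: (lawY N _ (mA eta)).
apply/cvgr0Pnorm_le => eps eps0.
have eps20 : 0 < eps / 2 by rewrite divr_gt0.
have [s0 s00 tail] := normal_prob_tail eta20 eps20.
(* Dividing by tau^2 + 1 rather than by tau^2 covers tau = 0. *)
have s0t : 0 < (s0 ^+ 2) / (tau ^+ 2 + 1).
  by rewrite divr_gt0 ?exprn_gt0// ltr_wpDl// sqr_ge0.
have /cvgr0Pnorm_le/(_ _ s0t) aN := a0.
have /cvgr0Pnorm_le/(_ _ eps20) YZN := YZ _ eta20.
near=> N.
rewrite ger0_norm ?fine_ge0//.
have mYl y : measurable [set w | y <= `|Y N w|] by exact: measurable_normge.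
have mZl y : measurable [set w | y <= `|Z N w|] by exact: measurable_normge.
have mYZ y : measurable [set w | y <= `|Y N w - Z N w|].
  by apply: measurable_normge; exact: measurable_funB.
apply: (@le_trans _ _ (fine (P' [set w | eta / 2 <= `|Z N w|]) +
    fine (P' [set w | eta / 2 <= `|Y N w - Z N w|]))).
  apply: fine_probability_leU => // w /= Yw.
  have [|] := leP (eta / 2) `|Z N w|; first by left.
  move=> Zw; right => /=; have := ler_normD (Y N w - Z N w) (Z N w).
  by rewrite subrK => ?; lra.
rewrite [leRHS]splitr lerD//; last first.
  by apply: le_trans (ler_norm _) _; near: N.
have : 0 <= \sum_(1 <= i < (m N).+1) (tau * a N i) ^+ 2.
  by apply: sumr_ge0 => i _; exact: sqr_ge0.
rewrite le_eqVlt => /predU1P[/esym s0E|s_gt0].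
  rewrite (_ : [set w | _] = set0) ?measure0 ?ltW//.
  by rewrite -subset0 => w /=; rewrite (Z0 _ _ s0E) normr0 leNgt eta20.
rewrite [X in fine X](lawZ N _ (mA (eta / 2)))//.
apply: tail; first by rewrite sqrtr_gt0.
rewrite -(ger0_norm (ltW s00)) -sqrtr_sqr ler_sqrt ?sqr_ge0//.
under eq_bigr do rewrite exprMn; rewrite -mulr_sumr.
have : \sum_(1 <= i < (m N).+1) a N i ^+ 2 <= s0 ^+ 2 / (tau ^+ 2 + 1).
  by apply: le_trans (ler_norm _) _; near: N.
have t1 : 0 < tau ^+ 2 + 1 by rewrite ltr_wpDl// sqr_ge0.
rewrite ler_pdivlMr// mulrC; apply: le_trans.
rewrite ler_wpM2r ?lerDl// sumr_ge0// => i _; exact: sqr_ge0.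
Unshelve. all: by end_near. Qed.

(** * Summation by parts and the growth of the invariance error *)

(** Summation by parts on the block from [p + 1] to [q]: the partial sums
    restarted at [p] are differences of two partial sums from 1, hence at most
    [2 M] in absolute value. *)
Lemma abel_bound (R : realType) (s u : nat -> R) (M : R) (p q : nat) :
  (p <= q)%N ->
  (forall i, (i <= q)%N -> `|\sum_(1 <= l < i.+1) u l| <= M) ->
  `|\sum_(p.+1 <= i < q.+1) s i * u i| <=
    2 * M * (`|s q| + \sum_(p.+2 <= i < q.+1) `|s i - s i.-1|).
Proof.
move=> pq uM.
pose S i := \sum_(p.+1 <= l < i.+1) u l.
have SS i : (p <= i)%N -> S i.+1 = S i + u i.+1.
  by move=> pi; rewrite /S big_nat_recr.
have Sp : S p = 0 by rewrite /S big_geq.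
have SM i : (p <= i <= q)%N -> `|S i| <= 2 * M.
  move=> /andP[pi iq].
  have -> : S i = \sum_(1 <= l < i.+1) u l - \sum_(1 <= l < p.+1) u l.
    by rewrite (@big_cat_nat _ _ _ p.+1 1 i.+1)//= addrAC subrr add0r.
  rewrite (le_trans (ler_normB _ _))// mulr2n mulrDl mul1r lerD ?uM//.
(* The summand at i = p + 1 vanishes since S p = 0; keeping it makes the
   induction uniform. *)
have abel i : (p <= i)%N -> \sum_(p.+1 <= l < i.+1) s l * u l =
    s i * S i - \sum_(p.+1 <= l < i.+1) (s l - s l.-1) * S l.-1.
  elim: i => [|i IH]; first by rewrite leqn0 => /eqP p0; rewrite /S p0 !big_geq// mulr0 subr0.
  rewrite leq_eqVlt => /predU1P[pE|].
    by rewrite -pE Sp !big_geq// mulr0 subr0.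
  rewrite ltnS => pi; rewrite !(big_nat_recr i.+1)//= IH// SS//; ring.
rewrite abel// mulrDr (le_trans (ler_normB _ _))// lerD//.
  by rewrite normrM mulrC ler_wpM2r// SM// pq leqnn.
have [qp|{}pq] := leqP q p.
  by rewrite !big_geq ?ltnS// ?normr0 ?mulr0// ltnW.
rewrite big_ltn// [S _]Sp mulr0 add0r mulr_sumr (le_trans (ler_norm_sum _ _ _))//.
rewrite big_nat_cond [leRHS]big_nat_cond ler_sum// => i /andP[/andP[pi iq] _].
by rewrite normrM mulrC ler_wpM2r// SM//; lia.
Qed.

(** The fourth root of [C] is at most [C], and [ln (C n) <= 2 ln n] once
    [C <= n]. *)
Lemma Delta_mul_bound (R : realType) (C n : nat) :
  (0 < C)%N -> (C <= n)%N -> Delta (C * n) <= 2 * C%:R * Delta n :> R.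
Proof.
move=> C0 Cn; have n0 : (0 < n)%N by exact: leq_trans Cn.
have C1 : 1 <= C%:R :> R by rewrite ler1n.
have Cp : 0 < C%:R :> R by rewrite ltr0n.
have np : 0 < n%:R :> R by rewrite ltr0n.
rewrite /Delta natrM powRM ?ler0n// lnM ?posrE//.
have : C%:R `^ (1 / 4) <= C%:R :> R by rewrite ler1_powR//; lra.
have : ln C%:R <= ln n%:R :> R by rewrite ler_ln ?posrE// ler_nat.
have : 0 <= ln C%:R :> R by rewrite ln_ge0.
have := powR_ge0 (n%:R : R) (1 / 4); have := powR_ge0 (C%:R : R) (1 / 4).
set a := C%:R `^ _; set b := n%:R `^ _; set c := ln _; set e := ln _.
move=> a0 b0 c0 ce aC.
rewrite [leRHS](_ : _ = (C%:R * b) * (2 * e)); last by ring.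
by apply: ler_pM; [exact: mulr_ge0|lra|rewrite ler_wpM2r|lra].
Qed.

Lemma Delta_ge0 (R : realType) (n : nat) : 0 <= Delta n :> R.
Proof.
rewrite mulr_ge0 ?powR_ge0//; have [->|n0] := posnP n; first by rewrite ln0.
by rewrite ln_ge0// ler1n.
Qed.

(** Passes from the rate at the end of the whole sample, where the invariance
    error is measured, to the rate at the length of one period. *)
Lemma partial_sums_bound_cvg0 (R : realType) (u v : nat -> R) (n m : nat -> nat)
    (C : nat) :
  (fun i : nat => \big[Num.max/0]_(1 <= l < i.+1) `|\sum_(1 <= h < l.+1) u h|)
      =o_\oo Delta ->
  n @ \oo --> \oo -> (\forall N \near \oo, (m N <= C * n N)%N) ->
  (forall N, 0 <= v N) ->
  (fun N => v N * Delta (n N)) @ \oo --> (0 : R) ->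
  (fun N => v N * \big[Num.max/0]_(1 <= l < (m N).+1) `|\sum_(1 <= h < l.+1) u h|)
    @ \oo --> (0 : R).
Proof.
move=> /eqoP uo noo; wlog C0 : C / (0 < C)%N.
  move=> H mC; apply: (H C.+1) => //; apply: filterS mC => N /leq_trans; apply.
  by rewrite leq_mul2r leqnSn orbT.
move=> mC v0 vD.
have big_ge0 i : 0 <= \big[Num.max/0]_(1 <= l < i.+1) `|\sum_(1 <= h < l.+1) u h|.
  by apply: bigmax_ge_id.
apply: (@squeeze_cvgr _ _ _ _ (cst 0) (fun N => 2 * C%:R * (v N * Delta (n N)))); last 2 first.
- exact: cvg_cst.
- by rewrite -[X in _ --> X](mulr0 (2 * C%:R)); apply: cvgMr.
have [K _ HK] := uo 1 ltr01.
have nbig : \forall N \near \oo, (maxn K C <= n N)%N by move/cvgnyPge : noo; exact.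
near=> N; rewrite mulr_ge0//=.
have mN : (m N <= C * n N)%N by near: N.
have nN : (maxn K C <= n N)%N by near: N.
rewrite mulrCA ler_wpM2l// (le_trans _ (Delta_mul_bound R C0 _))//; last first.
  by apply: leq_trans nN; rewrite leq_maxr.
apply: (@le_trans _ _ (\big[Num.max/0]_(1 <= l < (C * n N).+1) `|\sum_(1 <= h < l.+1) u h|)).
  exact: le_bigmax_nat.
have : (K <= C * n N)%N.
  by rewrite (leq_trans (leq_maxl K C))// (leq_trans nN)// leq_pmull.
move=> /HK /=; rewrite mul1r [X in _ <= X]ger0_norm ?Delta_ge0//.
by rewrite ger0_norm.
Unshelve. all: by end_near. Qed.

(** * Weights attached to the periods *)

Lemma endpointS (k : nat) (n : 'I_k -> nat) (j : 'I_k) :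
  endpoint n j.+1 = (endpoint n j + n j)%N.
Proof.
rewrite /endpoint (bigD1 j)//= addnC; congr (_ + _)%N.
by apply: eq_bigl => l; rewrite ltnS andbC -val_eqE/= ltn_neqAle.
Qed.

Lemma endpoint_le (k : nat) (n : 'I_k -> nat) (j j' : nat) :
  (j <= j')%N -> (endpoint n j <= endpoint n j')%N.
Proof.
move=> jj'; rewrite /endpoint big_mkcond [leqRHS]big_mkcond/=.
apply: leq_sum => l _; case: ifP => // lj.
by rewrite (leq_trans lj jj').
Qed.

Lemma mem_period (k : nat) (n : 'I_k -> nat) (j : 'I_k) (i : nat) :
  (i \in period n j) = (endpoint n j < i <= endpoint n j.+1)%N.
Proof. by rewrite mem_index_iota ltnS. Qed.

Lemma period_inj (k : nat) (n : 'I_k -> nat) (j j' : 'I_k) (i : nat) :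
  i \in period n j -> i \in period n j' -> j = j'.
Proof.
wlog jj' : j j' / (j <= j')%N.
  by move=> H; have [/H//|/ltnW /H] := leqP j j'; move=> h ? ?; apply/esym/h.
rewrite !mem_period => /andP[_ ij] /andP[j'i _].
apply/val_inj/eqP; rewrite eqn_leq jj'/= leqNgt; apply/negP => lt.
have := leq_trans j'i ij; rewrite ltnNge => /negP; apply.
exact: endpoint_le.
Qed.

Lemma sum_in_period (R : realType) (k : nat) (n : 'I_k -> nat) (j : 'I_k)
    (f : nat -> R) :
  \sum_(1 <= i < (endpoint n k).+1) (if i \in period n j then f i else 0) =
  \sum_(i <- period n j) f i.
Proof.
rewrite -big_mkcond/= /period.
rewrite (@big_nat_widen _ _ _ _ (endpoint n j.+1).+1 (endpoint n k).+1)//=; last first.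
  by rewrite ltnS endpoint_le.
rewrite (@big_nat_widenl _ _ _ (endpoint n j).+1 1)//.
by apply: eq_bigl => i; rewrite mem_period ltnS andbC.
Qed.

(** A combination of period sums seen as one linear statistic of the whole
    sample. At most one term is nonzero, as the periods are disjoint. *)
Definition period_weight (R : realType) (k : nat) (n : 'I_k -> nat)
    (c : 'I_k -> R) (s : nat -> R) (i : nat) : R :=
  \sum_(j < k) (if i \in period n j then c j * s i else 0).

Lemma sum_period_weight (R : realType) (k : nat) (n : 'I_k -> nat)
    (c : 'I_k -> R) (s f : nat -> R) :
  \sum_(1 <= i < (endpoint n k).+1) period_weight n c s i * f i =
  \sum_(j < k) c j * \sum_(i <- period n j) s i * f i.
Proof.
under eq_bigr do rewrite mulr_suml.
rewrite exchange_big/=; apply: eq_bigr => j _.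
rewrite mulr_sumr -sum_in_period; apply: eq_bigr => i _.
by case: ifP; rewrite ?mul0r ?mulrA.
Qed.

(** Disjointness of the periods removes the cross terms of the square. *)
Lemma sum_sqr_period_weight (R : realType) (k : nat) (n : 'I_k -> nat)
    (c : 'I_k -> R) (s : nat -> R) :
  \sum_(1 <= i < (endpoint n k).+1) period_weight n c s i ^+ 2 =
  \sum_(j < k) c j ^+ 2 * Sigma2 n s j.
Proof.
have sqE i : period_weight n c s i ^+ 2 =
    \sum_(j < k) (if i \in period n j then (c j * s i) ^+ 2 else 0).
  rewrite /period_weight.
  have [/existsP[j ij]|/existsPn nij] := boolP [exists j : 'I_k, i \in period n j].
    rewrite (bigD1 j)//= ij [RHS](bigD1 j)//= ij.
    rewrite !big1 ?addr0//= => l lj; case: ifP => // il;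
      by rewrite (period_inj ij il) eqxx in lj.
  by rewrite !big1 ?expr0n//= => j _; rewrite (negbTE (nij j)).
under eq_bigr do rewrite sqE.
rewrite exchange_big/=; apply: eq_bigr => j _.
rewrite sum_in_period /Sigma2 mulr_sumr.
by apply: eq_bigr => i _; rewrite exprMn.
Qed.

Lemma weight_variation_ge0 (R : realType) (k : nat) (n : 'I_k -> nat)
    (s : nat -> R) (j : 'I_k) : 0 <= weight_variation n s j.
Proof. by rewrite addr_ge0// sumr_ge0. Qed.

Lemma period_weight_annihilates (R : realType) (k : nat) (n : nat -> 'I_k -> nat)
    (c : nat -> 'I_k -> R) (s : nat -> nat -> R) (C : nat) (u : nat -> R) :
  (forall j : 'I_k, (fun N => n N j) @ \oo --> \oo) ->
  (\forall N \near \oo, forall j : 'I_k, (endpoint (n N) k <= C * n N j)%N) ->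
  (forall j : 'I_k, (fun N => `|c N j| * weight_variation (n N) (s N) j * Delta (n N j))
    @ \oo --> (0 : R)) ->
  (fun m : nat => \big[Num.max/0]_(1 <= i < m.+1) `|\sum_(1 <= l < i.+1) u l|)
      =o_\oo Delta ->
  (fun N => \sum_(1 <= i < (endpoint (n N) k).+1)
     period_weight (n N) (c N) (s N) i * u i) @ \oo --> (0 : R).
Proof.
move=> noo nC cv uo.
pose M N := \big[Num.max/0]_(1 <= i < (endpoint (n N) k).+1) `|\sum_(1 <= l < i.+1) u l|.
have M0 N : 0 <= M N by exact: bigmax_ge_id.
have uM N i : (i <= endpoint (n N) k)%N -> `|\sum_(1 <= l < i.+1) u l| <= M N.
  case: i => [|i] iN; first by rewrite big_geq// normr0.
  apply: (le_bigmax_seq 0 i.+1 xpredT (fun i => `|\sum_(1 <= l < i.+1) u l|)) => //.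
  by rewrite mem_index_iota/= ltnS.
have bound0 : (fun N => \sum_(j < k) 2 * (`|c N j| * weight_variation (n N) (s N) j * M N))
    @ \oo --> (0 : R).
  rewrite [X in _ --> X](_ : _ = \sum_(j < k) (0 : R)); last by rewrite big1.
  apply: cvg_big => [|j _]; first exact: add_continuous.
  rewrite -[X in _ --> X](mulr0 2); apply: cvgMr.
  apply: (partial_sums_bound_cvg0 uo (noo j)) => //.
    by apply: filterS nC => N; apply.
  by move=> N; rewrite mulr_ge0// weight_variation_ge0.
apply: (@squeeze_cvgr _ _ _ _
  (fun N => - \sum_(j < k) 2 * (`|c N j| * weight_variation (n N) (s N) j * M N))
  (fun N => \sum_(j < k) 2 * (`|c N j| * weight_variation (n N) (s N) j * M N))).
- apply: nearW => N; rewrite -ler_norml sum_period_weight.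
  apply: le_trans (ler_norm_sum _ _ _) _; apply: ler_sum => j _.
  rewrite normrM -mulrA mulrCA ler_wpM2l//.
  rewrite [leRHS](_ : _ = 2 * M N * weight_variation (n N) (s N) j); last by ring.
  apply: abel_bound; first exact: endpoint_le.
  by move=> i /leq_trans iN; apply: uM; apply: iN; exact: endpoint_le.
- by rewrite -[X in _ --> X]oppr0; apply: cvgN; exact: bound0.
- exact: bound0.
Qed.

(** * The studentized statistic *)

(** The case of [period_weight] where all coefficients but one are 0. *)
Lemma single_period_cvg0 (R : realType) (d : measure_display)
    (T : measurableType d) (P : probability T R) (x : nat -> T -> R) (tau : R)
    (k : nat) (n : nat -> 'I_k -> nat) (C : nat) (j : 'I_k)
    (g : nat -> R) (s : nat -> nat -> R) :
  strong_invariance_principle P x tau Delta ->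
  (forall j : 'I_k, (fun N => n N j) @ \oo --> \oo) ->
  (\forall N \near \oo, forall j : 'I_k, (endpoint (n N) k <= C * n N j)%N) ->
  (fun N => `|g N| * weight_variation (n N) (s N) j * Delta (n N j)) @ \oo
    --> (0 : R) ->
  (fun N => g N ^+ 2 * Sigma2 (n N) (s N) j) @ \oo --> (0 : R) ->
  forall eta : R, 0 < eta ->
    (fun N => fine (P [set w | eta <= `|g N * \sum_(i <- period (n N) j) s N i * x i w|]))
      @ \oo --> (0 : R).
Proof.
move=> sip noo nC gv g0 eta eta0.
pose c N (l : 'I_k) := if l == j then g N else 0.
have sumc N (h : 'I_k -> R) (f : R -> R) : f 0 = 0 -> \sum_(l < k) f (c N l) * h l = f (g N) * h j.
  move=> f0; rewrite (bigD1 j)//= big1 ?addr0; first by rewrite /c eqxx.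
  by move=> l /negPf lj; rewrite /c lj f0 mul0r.
have sum1 N w : g N * \sum_(i <- period (n N) j) s N i * x i w =
    \sum_(1 <= i < (endpoint (n N) k).+1) period_weight (n N) (c N) (s N) i * x i w.
  by rewrite sum_period_weight (sumc _ _ id).
under eq_fun do under eq_set do rewrite sum1.
apply: (linear_statistic_cvg0 sip) => //.
- move=> u uo; apply: (@period_weight_annihilates _ _ _ _ _ C) => // l.
  rewrite /c; have [->//|_] := eqVneq l j.
  by under eq_fun do rewrite normr0 !mul0r; exact: cvg_cst.
- under eq_fun do rewrite sum_sqr_period_weight (sumc _ _ (fun y => y ^+ 2)) ?expr0n//.
  exact: g0.
Qed.

Lemma fine_probability_bigsetU (R : realType) (d : measure_display)
    (T : measurableType d) (P : probability T R) (k : nat) (A : 'I_k -> set T) :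
  (forall j, measurable (A j)) ->
  fine (P (\big[setU/set0]_(j < k) A j)) <= \sum_(j < k) fine (P (A j)).
Proof.
move=> mA; elim: (index_enum _) => [|j r IH].
  by rewrite !big_nil measure0.
rewrite !big_cons; apply: le_trans (lerD (lexx _) IH).
apply: fine_probability_leU => //.
  by apply: measurableU => //; exact: bigsetU_measurable.
exact: bigsetU_measurable.
Qed.

Lemma sum_period_cst (R : realType) (k : nat) (n : 'I_k -> nat) (j : 'I_k) (z : R) :
  \sum_(i <- period n j) z = (n j)%:R * z.
Proof.
rewrite big_const_seq count_predT size_iota endpointS subSS addKn.
by rewrite iter_addr_0 mulr_natl.
Qed.

Lemma sample_meanE (R : realType) (k : nat) (n : 'I_k -> nat) (j : 'I_k)
    (mu : R) (s e x : nat -> R) :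
  (0 < n j)%N -> (forall i, i \in period n j -> x i = mu + s i * e i) ->
  sample_mean n x j = mu + (n j)%:R^-1 * \sum_(i <- period n j) s i * e i.
Proof.
move=> n0 xE; rewrite /sample_mean (eq_big_seq _ xE) big_split/= sum_period_cst.
by rewrite mulrDr mulrA mulVf ?mul1r// pnatr_eq0 -lt0n.
Qed.

(** Expand the square around [mu] and replace [e_i^2] by [1 + (e_i^2 - 1)];
    the correction for the estimated mean is the square of the normalised
    period sum. *)
Lemma square_deviations (R : realType) (k : nat) (n : 'I_k -> nat) (j : 'I_k)
    (mu : R) (s e x : nat -> R) :
  (0 < n j)%N -> 0 < Sigma2 n s j ->
  (forall i, i \in period n j -> x i = mu + s i * e i) ->
  \sum_(i <- period n j) (x i - sample_mean n x j) ^+ 2 =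
  Sigma2 n s j *
   (1 + (Sigma2 n s j)^-1 * \sum_(i <- period n j) s i ^+ 2 * (e i ^+ 2 - 1)
      - ((Num.sqrt (Sigma2 n s j) * Num.sqrt (n j)%:R)^-1 *
          \sum_(i <- period n j) s i * e i) ^+ 2).
Proof.
move=> n0 S0 xE.
have nR : (n j)%:R != 0 :> R by rewrite pnatr_eq0 -lt0n.
pose W := \sum_(i <- period n j) s i * e i.
have meanE : sample_mean n x j = mu + (n j)%:R^-1 * W by exact: sample_meanE.
have -> : \sum_(i <- period n j) (x i - sample_mean n x j) ^+ 2 =
    \sum_(i <- period n j) (s i ^+ 2 * e i ^+ 2) - (n j)%:R^-1 * W ^+ 2.
  rewrite (eq_big_seq (fun i => s i ^+ 2 * e i ^+ 2 +
      (- 2 * (n j)%:R^-1 * W * (s i * e i) + ((n j)%:R^-1 * W) ^+ 2))); last first.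
    by move=> i /xE ->; rewrite meanE; ring.
  rewrite big_split/= big_split/= -mulr_sumr -/W sum_period_cst; by field.
have -> : \sum_(i <- period n j) s i ^+ 2 * e i ^+ 2 = Sigma2 n s j +
    \sum_(i <- period n j) s i ^+ 2 * (e i ^+ 2 - 1).
  by rewrite /Sigma2 -big_split/=; apply: eq_bigr => i _; ring.
rewrite -/W exprMn exprVn exprMn !sqr_sqrtr ?ler0n ?ltW//; field.
by rewrite nR gt_eqF.
Qed.

(** For [0 <= delta <= 1], [(1 - delta)^2 <= 1 - delta] and
    [1 + delta <= (1 + delta)^2], so the relative error does not grow when the
    square root is taken. *)
Lemma sqrt_ratio_close (R : realType) (L V delta : R) :
  0 < V -> 0 <= delta <= 1 -> `|L - V ^+ 2| <= delta * V ^+ 2 ->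
  (1 - delta) * V <= Num.sqrt L <= (1 + delta) * V.
Proof.
move=> V0 /andP[d0 d1]; rewrite ler_norml => /andP[Ll Lr].
have V2 : 0 <= V ^+ 2 by exact: sqr_ge0.
apply/andP; split.
  have p0 : 0 <= (1 - delta) * V by rewrite mulr_ge0 ?subr_ge0// ltW.
  rewrite -[leLHS]ger0_norm// -sqrtr_sqr.
  rewrite ler_wsqrtr// exprMn.
  have : (1 - delta) ^+ 2 * V ^+ 2 <= (1 - delta) * V ^+ 2.
    by rewrite ler_wpM2r//; nra.
  lra.
have p0 : 0 <= (1 + delta) * V by rewrite mulr_ge0 ?addr_ge0// ltW.
rewrite -[leRHS]ger0_norm// -sqrtr_sqr.
rewrite ler_wsqrtr// exprMn.
have : (1 + delta) * V ^+ 2 <= (1 + delta) ^+ 2 * V ^+ 2.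
  by rewrite ler_wpM2r//; nra.
lra.
Qed.

(** * Measurability and comparability of the periods *)

Lemma measurable_sum_in (R : realType) (d : measure_display)
    (T : measurableType d) (I : eqType) (r : seq I) (f : I -> T -> R) :
  (forall i, i \in r -> measurable_fun setT (f i)) ->
  measurable_fun setT (fun w => \sum_(i <- r) f i w).
Proof.
elim: r => [|i r IH] mf.
  by under eq_fun do rewrite big_nil; exact: measurable_cst.
under eq_fun do rewrite big_cons.
apply: measurable_funD; first by apply: mf; rewrite mem_head.
by apply: IH => l lr; apply: mf; rewrite inE lr orbT.
Qed.

(** The inverse is treated as the power of exponent -1, which agrees with it
    on nonnegative reals, 0 included. *)
Lemma measurable_inv_sqrt (R : realType) (d : measure_display)
    (T : measurableType d) (f : T -> R) :
  measurable_fun setT f -> measurable_fun setT (fun w => (Num.sqrt (f w))^-1).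
Proof.
move=> mf.
rewrite (_ : (fun w => _) = fun w => Num.sqrt (f w) `^ (-1)); last first.
  by apply/funext => w; rewrite powR_inv1// sqrtr_ge0.
apply: (measurableT_comp (f := fun y : R => y `^ (-1))) => //.
apply: (measurableT_comp (f := @Num.sqrt R)) => //.
by apply: continuous_measurable_fun; exact: sqrt_continuous.
Qed.

Lemma measurable_studentized (R : realType) (d : measure_display)
    (T : measurableType d) (k : nat) (n : 'I_k -> nat) (beta : 'I_k -> R)
    (nu : R) (X : nat -> T -> R) :
  (forall j i, i \in period n j -> measurable_fun setT (X i)) ->
  measurable_fun setT (fun w =>
    (\sum_(j < k) beta j * sample_mean n (fun i => X i w) j - nu)
      / Lambda n beta (fun i => X i w)).
Proof.
move=> mX.
have mmean j : measurable_fun setT (fun w => sample_mean n (fun i => X i w) j).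
  by apply: measurable_funM => //; apply: measurable_sum_in => i; exact: mX.
apply: measurable_funM.
  apply: measurable_funB => //; apply: measurable_sum => j.
  exact: measurable_funM.
apply: measurable_inv_sqrt; apply: measurable_sum => j; apply: measurable_funM => //.
apply: measurable_sum_in => i ij; apply: measurable_funX.
by apply: measurable_funB => //; exact: mX ij.
Qed.

(** The whole sample is a sum of [k] period lengths, each a bounded multiple of
    any other. *)
Lemma comparable_endpoint (R : realType) (k : nat) (n : nat -> 'I_k -> nat) :
  (forall j : 'I_k, (fun N => n N j) @ \oo --> \oo) ->
  (forall j l : 'I_k, exists c C : R, 0 < c /\
    \forall N \near \oo, c <= (n N j)%:R / (n N l)%:R <= C) ->
  exists C : nat,
    \forall N \near \oo, forall j : 'I_k, (endpoint (n N) k <= C * n N j)%N.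
Proof.
move=> noo comp.
have /choice[K HK] : forall p : 'I_k * 'I_k, exists K : nat,
    \forall N \near \oo, (n N p.1 <= K * n N p.2)%N.
  move=> [j l] /=; have [c [C [_ HC]]] := comp j l.
  have n0 : \forall N \near \oo, (0 < n N l)%N by have /cvgnyPge := noo l; exact.
  exists (Num.truncn C).+1; apply: filterS2 HC n0 => N /andP[_ HN] nl.
  rewrite -(ler_nat R) natrM -ler_pdivrMr ?ltr0n//.
  by rewrite (le_trans HN)// ltW// truncnS_gt.
exists (\sum_(l < k) \sum_(j < k) K (l, j))%N.
have : \forall N \near \oo, forall p : 'I_k * 'I_k, (n N p.1 <= K p * n N p.2)%N.
  by apply: filter_forall => p; exact: HK.
apply: filterS => N HN j; rewrite /endpoint.
under eq_bigl do rewrite ltn_ord.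
rewrite big_distrl/=; apply: leq_sum => l _.
apply: leq_trans (HN (l, j)) _; rewrite leq_mul2r (bigD1 j)//= leq_addr orbT//.
Qed.

Lemma Sigma2_gt0 (R : realType) (k : nat) (n : 'I_k -> nat) (s : nat -> R)
    (j : 'I_k) :
  (0 < n j)%N -> (forall i, i \in period n j -> 0 < s i) -> 0 < Sigma2 n s j.
Proof.
move=> n0 s0; rewrite /Sigma2 /period big_ltn; last first.
  by rewrite endpointS ltnS -[X in (X < _)%N]addn0 ltn_add2l.
rewrite ltr_wpDr ?exprn_gt0//.
  by rewrite sumr_ge0// => i _; exact: sqr_ge0.
by apply: s0; rewrite mem_period leqnn/= endpointS -[X in (X < _)%N]addn0 ltn_add2l.
Qed.

(** * The target standard deviation *)

Definition sd_target (R : realType) (k : nat) (n : 'I_k -> nat)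
    (beta : 'I_k -> R) (s : nat -> R) : R :=
  Num.sqrt (\sum_(j < k) beta j ^+ 2 / (n j)%:R ^+ 2 * Sigma2 n s j).

Lemma sd_target_sqr (R : realType) (k : nat) (n : 'I_k -> nat)
    (beta : 'I_k -> R) (s : nat -> R) :
  sd_target n beta s ^+ 2 = \sum_(j < k) beta j ^+ 2 / (n j)%:R ^+ 2 * Sigma2 n s j.
Proof.
rewrite sqr_sqrtr// sumr_ge0// => j _.
rewrite mulr_ge0 ?divr_ge0 ?sqr_ge0//.
by apply: sumr_ge0 => i _; exact: sqr_ge0.
Qed.

Lemma sd_target_gt0 (R : realType) (k : nat) (n : 'I_k -> nat)
    (beta : 'I_k -> R) (s : nat -> R) (j : 'I_k) :
  beta j != 0 -> (0 < n j)%N -> 0 < Sigma2 n s j -> 0 < sd_target n beta s.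
Proof.
move=> b0 n0 S0; rewrite sqrtr_gt0 (bigD1 j)//= ltr_wpDr//.
  rewrite sumr_ge0// => l _; rewrite mulr_ge0 ?divr_ge0 ?sqr_ge0//.
  by apply: sumr_ge0 => i _; exact: sqr_ge0.
by rewrite mulr_gt0// divr_gt0// exprn_even_gt0//= pnatr_eq0 -lt0n.
Qed.

(** One term of the sum defining the variance. It bounds the normalised
    coefficient [beta_j / (n_j V)] by [1 / Sigma_j], which is what turns the
    variance condition into a condition on the weights. *)
Lemma weighted_sigma_le_sd (R : realType) (k : nat) (n : 'I_k -> nat)
    (beta : 'I_k -> R) (s : nat -> R) (j : 'I_k) :
  `|beta j| / (n j)%:R * Num.sqrt (Sigma2 n s j) <= sd_target n beta s.
Proof.
have S0 l : 0 <= Sigma2 n s l by apply: sumr_ge0 => i _; exact: sqr_ge0.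
rewrite -[leLHS]ger0_norm ?mulr_ge0 ?divr_ge0 ?sqrtr_ge0// -sqrtr_sqr.
rewrite ler_wsqrtr// exprMn sqr_sqrtr// expr_div_n -normrX.
rewrite (bigD1 j)//= [`|_|]ger0_norm ?sqr_ge0// lerDl.
by rewrite sumr_ge0// => l _; rewrite mulr_ge0 ?divr_ge0 ?sqr_ge0.
Qed.

Lemma studentized_numerator (R : realType) (k : nat) (n : 'I_k -> nat)
    (mu beta : 'I_k -> R) (s e x : nat -> R) (V : R) :
  V != 0 -> (forall j, (0 < n j)%N) ->
  (forall j i, i \in period n j -> x i = mu j + s i * e i) ->
  \sum_(j < k) beta j * sample_mean n x j - \sum_(j < k) beta j * mu j =
  V * \sum_(j < k) beta j / ((n j)%:R * V) * \sum_(i <- period n j) s i * e i.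
Proof.
move=> V0 n0 xE; rewrite -sumrB mulr_sumr; apply: eq_bigr => j _.
have nR : (n j)%:R != 0 :> R by rewrite pnatr_eq0 -lt0n.
rewrite (sample_meanE (n0 j) (xE j)); field.
by rewrite V0 nR.
Qed.

(** The ratio of [Lambda ^+ 2] to the squared target is an average of the factors
    [1 + A_j - D_j^2] of [square_deviations], with the contributions of the
    periods as weights, so it is as close to 1 as the worst of them. *)
Lemma Lambda_close (R : realType) (k : nat) (n : 'I_k -> nat)
    (mu beta : 'I_k -> R) (s e x : nat -> R) (eps : R) :
  (forall j, (0 < n j)%N) -> (forall j, 0 < Sigma2 n s j) ->
  (forall j i, i \in period n j -> x i = mu j + s i * e i) ->
  0 < sd_target n beta s -> 0 <= eps <= 1 ->
  (forall j, `|(Sigma2 n s j)^-1 *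
     \sum_(i <- period n j) s i ^+ 2 * (e i ^+ 2 - 1)| <= eps / 2) ->
  (forall j, `|(Num.sqrt (Sigma2 n s j) * Num.sqrt (n j)%:R)^-1 *
     \sum_(i <- period n j) s i * e i| <= eps / 2) ->
  (1 - eps) * sd_target n beta s <= Lambda n beta x
    <= (1 + eps) * sd_target n beta s.
Proof.
move=> n0 S0 xE V0 eps01 Aeps Ceps; apply: sqrt_ratio_close => //.
rewrite sd_target_sqr -sumrB mulr_sumr.
apply: le_trans (ler_norm_sum _ _ _) _; apply: ler_sum => j _.
rewrite (square_deviations (mu := mu j) (s := s) (e := e))//; last first.
  by move=> i; exact: xE.
have := Aeps j; set A := (X in `|X| <= _).
have := Ceps j; set C := (X in `|X| <= _ -> _).
rewrite !ler_norml => /andP[C1 C2] /andP[A1 A2].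
set w := beta j ^+ 2 / _.
have w0 : 0 <= w by rewrite divr_ge0 ?sqr_ge0.
have wS : 0 <= w * Sigma2 n s j by rewrite mulr_ge0// ltW.
rewrite (_ : w * _ - _ = (A - C ^+ 2) * (w * Sigma2 n s j)); last by rewrite /A /C; ring.
move: eps01 => /andP[eps0 eps1].
have C0 : 0 <= C ^+ 2 by exact: sqr_ge0.
have Ce : C ^+ 2 <= eps / 2 by nra.
rewrite -mulNr; apply/andP; split; rewrite ler_wpM2r//; lra.
Qed.

Lemma nonneg_squeeze_cvg0 (R : realType) (f g : nat -> R) :
  (\forall N \near \oo, 0 <= f N <= g N) ->
  g @ \oo --> (0 : R) -> f @ \oo --> (0 : R).
Proof.
by move=> fg g0; apply: (squeeze_cvgr (f := cst 0) fg) => //; exact: cvg_cst.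
Qed.

Theorem proposition2p3 (R : realType) (d : measure_display)
    (T : measurableType d) (P : probability T R)
    (e : nat -> {RV P >-> R}) (tau tau_star : R)
    (k : nat) (mu beta : 'I_k -> R)
    (n : nat -> 'I_k -> nat) (sigma : nat -> nat -> R)
    (X : nat -> nat -> T -> R) (nu : R) :
  stationary P (fun i => e i : T -> R) ->
  (forall i : nat, (0 < i)%N -> ('E_P[e i] = 0)%E) ->
  (forall i : nat, (0 < i)%N -> ('E_P[fun w => (e i w ^+ 2)%R] = 1)%E) ->
  0 < tau -> 0 <= tau_star ->
  long_run_variance P (fun i => e i : T -> R) (tau ^+ 2) ->
  long_run_variance P (fun i w => e i w ^+ 2 - 1) (tau_star ^+ 2) ->
  strong_invariance_principle P (fun i => e i : T -> R) tau Delta ->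
  strong_invariance_principle P (fun i w => e i w ^+ 2 - 1) tau_star Delta ->
  (1 <= k)%N ->
  (exists j : 'I_k, beta j != 0) ->
  nu = \sum_(j < k) beta j * mu j ->
  (forall (N : nat) (j : 'I_k) (i : nat), i \in period (n N) j ->
    0 < sigma N i) ->
  (forall (N : nat) (j : 'I_k) (i : nat), i \in period (n N) j ->
    forall w, X N i w = mu j + sigma N i * e i w) ->
  (forall j : 'I_k, (fun N => n N j) @ \oo --> \oo) ->
  (forall j l : 'I_k, exists c C : R, 0 < c /\
    \forall N \near \oo, c <= (n N j)%:R / (n N l)%:R <= C) ->
  (forall j : 'I_k,
    (fun N : nat =>
       weight_variation (n N) (sigma N) j * Delta (n N j)
         / Num.sqrt (Sigma2 (n N) (sigma N) j)
       + (weight_variation (n N) (fun i => sigma N i ^+ 2) j * Delta (n N j)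
            + Sigma_star2 (n N) (sigma N) j)
         / Sigma2 (n N) (sigma N) j) @ \oo --> (0 : R)) ->
  cvg_in_distribution P
    (fun N w =>
       (\sum_(j < k) beta j * sample_mean (n N) (fun i => X N i w) j - nu)
       / Lambda (n N) beta (fun i => X N i w))
    (normal_prob 0 tau).
Proof.
move=> _ _ _ tau0 _ _ _ sip sip2 _ [j0 bj0] -> sigma0 XE noo comp hyp.
have [C nC] := comparable_endpoint noo comp.
pose S N j := Sigma2 (n N) (sigma N) j.
pose V N := sd_target (n N) beta (sigma N).
have n0 : \forall N \near \oo, forall j, (0 < n N j)%N.
  by apply: filter_forall => j; have /cvgnyPge := noo j; exact.
have S_gt0 N : (forall j, (0 < n N j)%N) -> forall j, 0 < S N j.
  by move=> nN j; apply: Sigma2_gt0 => // i; exact: sigma0.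
have V_gt0 N : (forall j, (0 < n N j)%N) -> 0 < V N.
  by move=> nN; apply: (sd_target_gt0 bj0) => //; exact: S_gt0.
have S_ge0 N j : 0 <= S N j by apply: sumr_ge0 => i _; exact: sqr_ge0.
pose r N j := weight_variation (n N) (sigma N) j.
pose r2 N j := weight_variation (n N) (fun i => sigma N i ^+ 2) j.
pose S4 N j := Sigma_star2 (n N) (sigma N) j.
have t1_ge0 N j : 0 <= r N j * Delta (n N j) / Num.sqrt (S N j).
  by rewrite divr_ge0 ?sqrtr_ge0// mulr_ge0 ?Delta_ge0// weight_variation_ge0.
have t2_ge0 N j : 0 <= r2 N j * Delta (n N j) / S N j.
  by rewrite divr_ge0// mulr_ge0 ?Delta_ge0// weight_variation_ge0.
have t3_ge0 N j : 0 <= S4 N j / S N j by rewrite divr_ge0// sqrtr_ge0.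
have hypE N j : r N j * Delta (n N j) / Num.sqrt (S N j) +
    (r2 N j * Delta (n N j) + S4 N j) / S N j =
    r N j * Delta (n N j) / Num.sqrt (S N j) + r2 N j * Delta (n N j) / S N j
      + S4 N j / S N j.
  by ring.
have t1_cvg j : (fun N => r N j * Delta (n N j) / Num.sqrt (S N j)) @ \oo --> (0 : R).
  apply: nonneg_squeeze_cvg0 (hyp j); apply: nearW => N.
  by have [[? ?] ?] := (t1_ge0 N j, t2_ge0 N j, t3_ge0 N j); rewrite hypE; lra.
have t2_cvg j : (fun N => r2 N j * Delta (n N j) / S N j) @ \oo --> (0 : R).
  apply: nonneg_squeeze_cvg0 (hyp j); apply: nearW => N.
  by have [[? ?] ?] := (t1_ge0 N j, t2_ge0 N j, t3_ge0 N j); rewrite hypE; lra.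
have t3_cvg j : (fun N => S4 N j / S N j) @ \oo --> (0 : R).
  apply: nonneg_squeeze_cvg0 (hyp j); apply: nearW => N.
  by have [[? ?] ?] := (t1_ge0 N j, t2_ge0 N j, t3_ge0 N j); rewrite hypE; lra.
(* The numerator divided by V N is the linear statistic U N, whose weights have
   unit square sum. *)
pose c N j := beta j / ((n N j)%:R * V N).
pose U N w := \sum_(1 <= i < (endpoint (n N) k).+1)
  period_weight (n N) (c N) (sigma N) i * e i w.
have mU N : measurable_fun setT (U N).
  by apply: measurable_sum => i; exact: measurable_funM.
have c_var N j : (forall j, (0 < n N j)%N) ->
    `|c N j| * r N j * Delta (n N j) <= r N j * Delta (n N j) / Num.sqrt (S N j).
  move=> nN; have VN := V_gt0 _ nN; have SN := S_gt0 _ nN j.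
  have nNj : 0 < (n N j)%:R :> R by rewrite ltr0n.
  rewrite -mulrA [leRHS]mulrC ler_wpM2r//.
    by rewrite mulr_ge0 ?Delta_ge0 ?weight_variation_ge0.
  rewrite -[leRHS]div1r ler_pdivlMr ?sqrtr_gt0//.
  rewrite /c normrM normfV normrM (gtr0_norm VN) (gtr0_norm nNj) invfM.
  rewrite mulrA mulrAC ler_pdivrMr// mul1r.
  exact: weighted_sigma_le_sd.
have clt : cdf_sandwich P U (normal_prob 0 tau).
  apply: (linear_statistic_clt tau0 sip).
    move=> u uo; apply: (period_weight_annihilates noo nC) => // j.
    apply: nonneg_squeeze_cvg0 (t1_cvg j); apply: filterS n0 => N nN.
    rewrite c_var// andbT.
    by rewrite mulr_ge0 ?Delta_ge0// mulr_ge0// weight_variation_ge0.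
  apply: filterS n0 => N nN; rewrite sum_sqr_period_weight.
  have VN := V_gt0 _ nN.
  have VN0 : V N != 0 by rewrite gt_eqF.
  transitivity ((V N ^+ 2)^-1 * V N ^+ 2); last by rewrite mulVf// expf_neq0.
  rewrite [X in _ = _ * X]sd_target_sqr mulr_sumr; apply: eq_bigr => j _.
  have nNj : (n N j)%:R != 0 :> R by rewrite pnatr_eq0 -lt0n.
  by rewrite /c; field; rewrite nNj.
(* The two relative errors of the denominator in period j: A comes from the
   fluctuation of the squares, D from the estimated mean. *)
pose A N j w := (S N j)^-1 *
  \sum_(i <- period (n N) j) sigma N i ^+ 2 * (e i w ^+ 2 - 1).
pose D N j w := (Num.sqrt (S N j) * Num.sqrt (n N j)%:R)^-1 *
  \sum_(i <- period (n N) j) sigma N i * e i w.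
have mA N j : measurable_fun setT (A N j).
  apply: measurable_funM => //; apply: measurable_sum => i.
  apply: measurable_funM => //; apply: measurable_funB => //.
  exact: measurable_funX.
have mD N j : measurable_fun setT (D N j).
  apply: measurable_funM => //; apply: measurable_sum => i.
  exact: measurable_funM.
have A_cvg0 j eta : 0 < eta ->
    (fun N => fine (P [set w | eta <= `|A N j w|])) @ \oo --> (0 : R).
  apply: (single_period_cvg0 sip2 noo nC
    (g := fun N => (S N j)^-1) (s := fun N i => sigma N i ^+ 2)).
    rewrite (_ : (fun N => _) = fun N => r2 N j * Delta (n N j) / S N j)//.
    by apply/funext => N; rewrite ger0_norm ?invr_ge0// /r2; ring.
  have -> : (fun N => (S N j)^-1 ^+ 2 * Sigma2 (n N) (fun i => sigma N i ^+ 2) j) =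
      fun N => (S4 N j / S N j) ^+ 2.
    apply/funext => N; rewrite expr_div_n exprVn mulrC; congr (_ / _).
    rewrite /S4 /Sigma_star2 sqr_sqrtr.
      by apply: eq_bigr => i _; rewrite -exprM.
    by apply: sumr_ge0 => i _; exact: exprn_even_ge0.
  by rewrite -[X in _ --> X](mul0r 0); apply: cvgM; exact: t3_cvg.
have D_cvg0 j eta : 0 < eta ->
    (fun N => fine (P [set w | eta <= `|D N j w|])) @ \oo --> (0 : R).
  apply: (single_period_cvg0 sip noo nC
    (g := fun N => (Num.sqrt (S N j) * Num.sqrt (n N j)%:R)^-1) (s := sigma)).
    apply: nonneg_squeeze_cvg0 (t1_cvg j); apply: filterS n0 => N nN.
    have nN1 : 1 <= Num.sqrt (n N j)%:R :> R
      by rewrite -[leLHS]sqrtr1; apply: ler_wsqrtr; rewrite ler1n.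
    apply/andP; split.
      by rewrite mulr_ge0 ?Delta_ge0// mulr_ge0// weight_variation_ge0.
    rewrite -mulrA [leRHS]mulrC ler_wpM2r//.
      by rewrite mulr_ge0 ?Delta_ge0 ?weight_variation_ge0.
    have SN : 0 < Num.sqrt (S N j) by rewrite sqrtr_gt0 S_gt0.
    rewrite ger0_norm ?invr_ge0 ?mulr_ge0 ?sqrtr_ge0//.
    rewrite lef_pV2 ?posrE ?mulr_gt0 ?(lt_le_trans ltr01 nN1)//.
    by rewrite ler_peMr// ltW.
  apply: (@cvg_trans _ ((fun N => (n N j)%:R^-1 : R) @ \oo)); last first.
    have npos : \forall N \near \oo, 0 < (n N j)%:R :> R.
      by apply: filterS n0 => N nN; rewrite ltr0n.
    by apply: (iffRL (gtr0_cvgV0 npos)); exact/cvgrnyP.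
  apply: near_eq_cvg; apply: filterS n0 => N nN.
  rewrite exprVn exprMn !sqr_sqrtr ?ler0n// invfM mulrAC mulVf ?mul1r//.
  by rewrite gt_eqF// S_gt0.
have mZ N : measurable_fun setT (fun w =>
    (\sum_(j < k) beta j * sample_mean (n N) (fun i => X N i w) j -
       \sum_(j < k) beta j * mu j) / Lambda (n N) beta (fun i => X N i w)).
  apply: measurable_studentized => j i ij.
  rewrite (_ : X N i = fun w => mu j + sigma N i * e i w); last first.
    by apply/funext => w; exact: XE ij w.
  by apply: measurable_funD => //; exact: measurable_funM.
apply: cdf_sandwich_cvg => //.
apply: (cdf_sandwich_perturb mU _ clt) => // x delta delta0.
have x1 : 0 < `|x| + 1 by rewrite ltr_wpDl.
(* An error eps in Lambda / V moves the level x by at most |x| eps. *)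
pose eps := Num.min (1 / 2) (delta / (`|x| + 1)).
have eps_gt0 : 0 < eps by rewrite lt_min divr_gt0// divr_gt0.
have eps_half : eps <= 1 / 2 by rewrite ge_min lexx.
have eps_delta : `|x| * eps <= delta.
  apply: (@le_trans _ _ (`|x| * (delta / (`|x| + 1)))).
    by rewrite ler_wpM2l// ge_min lexx orbT.
  by rewrite mulrA ler_pdivrMr// mulrC ler_wpM2l ?lerDl// ltW.
have eps20 : 0 < eps / 2 by rewrite divr_gt0.
pose bad1 N j := [set w | eps / 2 <= `|A N j w|] `|` [set w | eps / 2 <= `|D N j w|].
have mbad1 N j : measurable (bad1 N j).
  by apply: measurableU; exact: measurable_normge.
exists (fun N => \big[setU/set0]_(j < k) bad1 N j).
  split; first by move=> N; exact: bigsetU_measurable.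
  apply: (@nonneg_squeeze_cvg0 _ _ (fun N => \sum_(j < k)
    (fine (P [set w | eps / 2 <= `|A N j w|]) + fine (P [set w | eps / 2 <= `|D N j w|])))).
    apply: nearW => N; rewrite fine_ge0//=.
    apply: le_trans (fine_probability_bigsetU _ _) _ => //.
    apply: ler_sum => j _; apply: fine_probability_leU => //;
      exact: measurable_normge.
  rewrite [X in _ --> X](_ : _ = \sum_(j < k) (0 + 0 : R)); last first.
    by rewrite big1// => j _; rewrite addr0.
  apply: cvg_big => [|j _]; first exact: add_continuous.
  by apply: cvgD; [exact: A_cvg0|exact: D_cvg0].
apply: filterS n0 => N nN w nbad.
have notbad j : `|A N j w| <= eps / 2 /\ `|D N j w| <= eps / 2.
  split; rewrite leNgt; apply/negP => /ltW lt; apply: nbad;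
    rewrite -bigcup_seq; exists j; rewrite /= ?mem_index_enum//; by [left|right].
have VN := V_gt0 _ nN.
have eps01 : 0 <= eps <= 1 by rewrite ltW//= (le_trans eps_half)//; lra.
have := Lambda_close (e := fun i => e i w) (x := fun i => X N i w) (mu := mu)
  nN (S_gt0 _ nN) (fun j i ij => XE N j i ij w) VN eps01
  (fun j => (notbad j).1) (fun j => (notbad j).2).
rewrite (@studentized_numerator _ _ (n N) mu beta (sigma N) (fun i => e i w)
  (fun i => X N i w) (V N))//; last 2 first.
- by rewrite gt_eqF.
- by move=> j i ij; exact: XE.
rewrite -sum_period_weight -/(U N w) -/(V N).
set L := Lambda _ _ _ => /andP[L1 L2].
have L0 : 0 < L by apply: lt_le_trans L1; rewrite mulr_gt0//; lra.
have xL : `|x * (L - V N)| <= delta * V N.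
  rewrite normrM; apply: (@le_trans _ _ (`|x| * (eps * V N))).
    by rewrite ler_wpM2l// ler_norml; apply/andP; split; lra.
  by rewrite mulrA ler_wpM2r// ltW.
rewrite ler_pdivrMr//; move: xL; rewrite ler_norml => /andP[xL1 xL2].
split => H.
  by rewrite -(ler_pM2l VN); lra.
have : V N * U N w <= V N * (x - delta) by rewrite ler_pM2l.
lra.
Qed.
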